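(* Let $\mathscr{B}\subseteq\mathbb{N}$ be such that $\eta^*$ is a regular Toeplitz sequence. Then $$\mathcal{P}(X_\eta)=\mathcal{P}(X_\varphi)=\{(M_H)_\ast(m_H\vee\kappa):\kappa\in\mathcal{P}(\{0,1\}^{\mathbb{Z}})\},$$ where, on the right-hand side, $\kappa$ ranges over all $\sigma$-invariant Borel probability measures on $\{0,1\}^{\mathbb{Z}}$ and $m_H\vee\kappa$ ranges over all joinings of $m_H$ and $\kappa$.
   Context: $\mathbb{N}=\{1,2,\dots\}$. For $\mathscr{A}\subseteq\mathbb{N}$: $\mathcal{M}_{\mathscr{A}}=\bigcup_{a\in\mathscr{A}}a\mathbb{Z}$, $\mathcal{F}_{\mathscr{A}}=\mathbb{Z}\setminus\mathcal{M}_{\mathscr{A}}$, and $\mathscr{A}^{prim}$ is the set of those $a\in\mathscr{A}$ not divisible by any other element of $\mathscr{A}$. Put $\eta=\mathbf{1}_{\mathcal{F}_{\mathscr{B}}}\in\{0,1\}^{\mathbb{Z}}$. Let $\sigma$ be the left shift on $\{0,1\}^{\mathbb{Z}}$; $X_\eta$ is the closure of $\{\sigma^k\eta:k\in\mathbb{Z}\}$. For a closed $\sigma$-invariant $X\subseteq\{0,1\}^{\mathbb{Z}}$, $\mathcal{P}(X)$ is the set of $\sigma$-invariant Borel probability measures on $X$. $\mathscr{B}^*=(\mathscr{B}\cup D)^{prim}$, where $D=\{d\in\mathbb{N}: d\mathcal{A}\subseteq\mathscr{B}\text{ for some infinite pairwise coprime set }\mathcal{A}\subseteq\mathbb{N}\}$,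 and $\eta^*=\mathbf{1}_{\mathcal{F}_{\mathscr{B}^*}}$. A sequence $x\in\{0,1\}^{\mathbb{Z}}$ is Toeplitz if for each $i\in\mathbb{Z}$ there is $s\in\mathbb{N}$ with $x(i+sk)=x(i)$ for all $k\in\mathbb{Z}$. Let $\mathrm{Per}(x,s)=\{i\in\mathbb{Z}: x(i+sk)=x(i)\text{ for all }k\in\mathbb{Z}\}$. A Toeplitz sequence $x$ is regular if $\lim_{r\to\infty}d\big(\bigcup_{s\le r}\mathrm{Per}(x,s)\big)=1$, where $d(A)=\lim_{L\to\infty}\frac1L|A\cap[1,L]|$. (The sequence $\eta^*$ is always Toeplitz.) Let $G=\prod_{b\in\mathscr{B}}\mathbb{Z}/b\mathbb{Z}$ (product topology), $\Delta:\mathbb{Z}\to G$, $\Delta(n)=(n,n,\dots)$, $H=\overline{\Delta(\mathbb{Z})}$, $m_H$ the normalized Haar measure of $H$, $R:H\to H$, $R(h)=h+\Delta(1)$. Let $W=\{h\in H:h_b\ne0\text{ for each }b\in\mathscr{B}\}$ and $\underline{W}=\overline{\mathrm{int}(W)}$ (interior and closure in $H$). Define $\varphi,\underline{\varphi}:H\to\{0,1\}^{\mathbb{Z}}$ by $\varphi(h)(n)=1\iff h+\Delta(n)\in W$ and $\underline{\varphi}(h)(n)=1\iff h+\Delta(n)\in\underline{W}$. Let $X_\varphi=\overline{\varphi(H)}$. $M_H:H\times\{0,1\}^{\mathbb{Z}}\to\{0,1\}^{\mathbb{Z}}$ is $M_H(h,x)=\underline{\varphi}(h)+x\cdot(\varphi(h)-\underline{\varphi}(h))$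 (coordinatewise operations). A joining $m_H\vee\kappa$ is any $(R\times\sigma)$-invariant Borel probability measure on $H\times\{0,1\}^{\mathbb{Z}}$ with marginals $m_H$ and $\kappa$. $f_\ast$ denotes push-forward of measures. *)

(* Defs.v *)
From HB Require Import structures.
From mathcomp Require Import all_boot all_order all_algebra.
From mathcomp Require Import all_classical all_reals all_analysis.

Set Implicit Arguments.
Unset Strict Implicit.
Unset Printing Implicit Defensive.

Import Order.TTheory GRing.Theory Num.Theory.
Import numFieldNormedType.Exports.

Local Open Scope classical_set_scope.
Local Open Scope ring_scope.

(** * Sets of multiples *)

(* Sets of positive integers are represented as [set nat] not containing 0. *)

Definition multiples_set (A : set nat) : set int :=
  \bigcup_(a in A) [set n : int | (a%:Z %| n)%Z].

Definition free_set (A : set nat) : set int := ~` multiples_set A.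

Definition primitive_set (A : set nat) : set nat :=
  [set a | A a /\ forall a', A a' -> (a' %| a)%N -> a' = a].

Definition pairwise_coprime (A : set nat) : Prop :=
  forall a a', A a -> A a' -> a != a' -> coprime a a'.

Definition dilated_coprime_set (B : set nat) : set nat :=
  [set d | (0 < d)%N /\
    exists A : set nat, [/\ infinite_set A, (forall a, A a -> (0 < a)%N),
      pairwise_coprime A & (forall a, A a -> B (d * a)%N)]].

Definition star_set (B : set nat) : set nat :=
  primitive_set (B `|` dilated_coprime_set B).

(** * The two-sided binary full shift *)

Notation biseq := {ptws int -> bool}.

Definition shift_seqn (k : int) (x : biseq) : biseq := fun n => x (n + k).
Definition shift_seq : biseq -> biseq := shift_seqn 1.

Definition eta_seq (B : set nat) : biseq := fun n => `[< free_set B n >].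

Definition X_eta (B : set nat) : set biseq :=
  closure (range (fun k => shift_seqn k (eta_seq B))).

(** * Toeplitz sequences *)

Definition period_set (x : biseq) (s : nat) : set int :=
  [set i | forall k : int, x (i + s%:Z * k) = x i].

Definition toeplitz (x : biseq) : Prop :=
  forall i, exists2 s : nat, (0 < s)%N & period_set x s i.

(* [lim] is total; the limit exists when A is periodic, as in
   [regular_toeplitz]. *)
Definition natural_density (R : realType) (A : set int) : R :=
  lim (((\sum_(1 <= k < L.+1) `[< A k%:Z >])%N%:R / L%:R : R) @[L --> \oo]).

Definition regular_toeplitz (R : realType) (x : biseq) : Prop :=
  toeplitz x /\
  natural_density R (\bigcup_(s in [set s | (1 <= s <= r)%N]) period_set x s)
    @[r --> \oo] --> (1 : R).

(** * Borel measures *)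

Notation borel T := (g_sigma_algebraType (@open T)).

Definition invariant_measure d (T : measurableType d) (R : realType)
    (f : T -> T) (mu : probability T R) : Prop :=
  forall A, measurable A -> mu (f @^-1` A) = mu A.

(* Probability measures on a closed set X of sequences are identified with the
   probability measures on the full shift giving mass 1 to X. *)
Definition inv_probability {R : realType} (X : set biseq) :
    set (probability (borel biseq) R) :=
  [set mu : probability (borel biseq) R |
    mu X = 1%E /\
    invariant_measure (shift_seq : borel biseq -> borel biseq) mu].

(** * The group H *)

(* Z/bZ with the discrete topology, for b > 0.  The carrier is that of 'I_b,
   written so that it is a group even for b = 1 (unlike 'Z_b). *)
Definition residue (b : nat) : Type := discrete_topology 'I_b.-1.+1.

HB.instance Definition _ b := DiscreteTopology.on (residue b).
HB.instance Definition _ b := GRing.Zmodule.copy (residue b) 'I_b.-1.+1.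

Definition residue1 (b : nat) : residue b := inZp 1.

Section group.
Variable B : set nat.

Definition Ggrp : Type := prod_topology (fun b : B => residue (\val b)).

HB.instance Definition _ := Topological.on Ggrp.

Let Gadd (g h : Ggrp) : Ggrp := fun b => g b + h b.
Let Gopp (g : Ggrp) : Ggrp := fun b => - g b.
Let Gzero : Ggrp := fun=> 0.

Let GaddA : associative Gadd.
Proof.
by move=> f g h; apply: functional_extensionality_dep => b; exact: addrA.
Qed.

Let GaddC : commutative Gadd.
Proof.
by move=> f g; apply: functional_extensionality_dep => b; exact: addrC.
Qed.

Let Gadd0 : left_id Gzero Gadd.
Proof.
by move=> f; apply: functional_extensionality_dep => b; exact: add0r.
Qed.

Let GaddN : left_inverse Gzero Gopp Gadd.
Proof.
by move=> f; apply: functional_extensionality_dep => b; exact: addNr.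
Qed.

HB.instance Definition _ := GRing.isZmodule.Build Ggrp GaddA GaddC Gadd0 GaddN.

Let Gsub_continuous : continuous (fun x : Ggrp * Ggrp => x.1 - x.2).
Proof.
move=> [x y]; apply/cvg_sup => b U [V [[V'] oW <-] WV VU].
apply: filterS VU _; rewrite nbhs_simpl /=.
have coord (z : Ggrp) : nbhs z [set w : Ggrp | w b = z b].
  have := @proj_continuous _ (fun b : B => residue (\val b)) b z [set z b].
  by apply; exact: (@discrete_set1 (residue (\val b))).
exists ([set w : Ggrp | w b = x b], [set w : Ggrp | w b = y b]) => //=.
move=> [u v] /= [ub vb]; move: WV => /=.
by rewrite /= /GRing.add/= /Gadd /= /GRing.opp /= /Gopp ub vb.
Qed.

HB.instance Definition _ :=
  PreTopologicalNmodule_isTopologicalZmodule.Build Ggrp Gsub_continuous.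

Definition Delta_G (n : int) : Ggrp := fun b => residue1 (\val b) *~ n.

Definition H_set : set Ggrp := closure (range Delta_G).

Let Delta0 : Delta_G 0 = 0.
Proof. by []. Qed.

Let DeltaB m n : Delta_G m - Delta_G n = Delta_G (m - n).
Proof.
by apply: functional_extensionality_dep => b; rewrite /Delta_G mulrzBr.
Qed.

Let Delta_H n : H_set (Delta_G n).
Proof. by apply: subset_closure; exists n. Qed.

Let H_setB x y : H_set x -> H_set y -> H_set (x - y).
Proof.
move=> Hx Hy U /(@sub_continuous Ggrp (x, y)) [[P Q] /= [Px Qy] PQU].
have [_ [[m _ <-] Pm]] := Hx _ Px; have [_ [[n _ <-] Qn]] := Hy _ Qy.
exists (Delta_G (m - n)); split; first by exists (m - n).
by rewrite -DeltaB; exact: (PQU (Delta_G m, Delta_G n)).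
Qed.

Let H_zmod_closed : zmod_closed (mem H_set).
Proof.
split=> [|x y]; first by apply/mem_set; rewrite -Delta0.
by move=> /set_mem Hx /set_mem Hy; apply/mem_set/H_setB.
Qed.

Definition Hgrp : Type := set_type H_set.

HB.instance Definition _ := Topological.on Hgrp.
HB.instance Definition _ := SubChoice.on Hgrp.
HB.instance Definition _ :=
  GRing.SubChoice_isSubZmodule.Build Ggrp _ Hgrp H_zmod_closed.
HB.instance Definition _ := isPointed.Build Hgrp 0.

Definition DeltaH (n : int) : Hgrp :=
  exist _ (Delta_G n) (mem_set (@Delta_H n)).

Definition rotation (h : Hgrp) : Hgrp := h + DeltaH 1.

Definition window : set Hgrp := [set h | forall b : B, \val h b != 0].

Definition window_reg : set Hgrp := closure window°.

Definition phi (h : Hgrp) : biseq := fun n => `[< window (h + DeltaH n) >].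

Definition phi_reg (h : Hgrp) : biseq :=
  fun n => `[< window_reg (h + DeltaH n) >].

Definition X_phi : set biseq := closure (range phi).

(* This is phi_reg h + x * (phi h - phi_reg h), see [M_HE]. *)
Definition M_H (hx : Hgrp * biseq) : biseq :=
  fun n => if hx.2 n then phi hx.1 n else phi_reg hx.1 n.

Lemma M_HE h x n : (M_H (h, x) n)%:Z =
  (phi_reg h n)%:Z + (x n)%:Z * ((phi h n)%:Z - (phi_reg h n)%:Z).
Proof.
by rewrite /M_H /=; case: (x n); rewrite ?mul0r ?addr0// mul1r addrC subrK.
Qed.

Section measures.
Variable R : realType.

(* The normalized Haar measure of H is the unique such mu; as H is compact and
   metrizable, Borel probability measures are automatically regular. *)
Definition is_haar (mu : probability (borel Hgrp) R) : Prop :=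
  forall h : Hgrp,
    invariant_measure ((fun g : Hgrp => h + g) : borel Hgrp -> borel Hgrp) mu.

Definition skew (hx : Hgrp * biseq) : Hgrp * biseq :=
  (rotation hx.1, shift_seq hx.2).

Definition is_joining (mu : probability (borel Hgrp) R)
    (kappa : probability (borel biseq) R)
    (rho : probability (borel (Hgrp * biseq)%type) R) : Prop :=
  [/\ invariant_measure
        (skew : borel (Hgrp * biseq)%type -> borel (Hgrp * biseq)%type) rho,
      forall A : set (borel Hgrp), measurable A -> rho (fst @^-1` A) = mu A &
      forall A : set (borel biseq), measurable A ->
        rho (snd @^-1` A) = kappa A].

(* Probability measures are compared on Borel sets only, because the values of
   a [probability] on non-measurable sets are irrelevant. *)
Definition M_H_images (mu : probability (borel Hgrp) R) :
    set (probability (borel biseq) R) :=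
  [set nu : probability (borel biseq) R |
    exists2 kappa, inv_probability [set: biseq] kappa &
    exists2 rho, is_joining mu kappa rho &
    forall A : set (borel biseq), measurable A ->
      nu A =
      pushforward rho (M_H : borel (Hgrp * biseq)%type -> borel biseq) A].

End measures.

End group.

Arguments window : clear implicits.
Arguments window_reg : clear implicits.
Arguments X_phi : clear implicits.
Arguments is_haar {B R} mu.
Arguments M_H_images {B R} mu.

(* Main.v *)
Require Import Defs.
From HB Require Import structures.
From mathcomp Require Import all_boot all_order all_algebra.
From mathcomp Require Import all_classical all_reals all_analysis.
From mathcomp Require Import zify ring lra.

Set Implicit Arguments.
Unset Strict Implicit.
Unset Printing Implicit Defensive.

Import Order.TTheory GRing.Theory Num.Theory.
Import numFieldNormedType.Exports.

Local Open Scope classical_set_scope.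
Local Open Scope ring_scope.

(** Let [D] be the set of the dilations that define [B*], and [C = B `|` D], so
that [eta*] is the indicator of the integers with no divisor in [C]. The three
sets of measures are compared along the chain

  P(X_eta) <= P(X_phi) <= { images of joinings under M_H } <= P(X_eta).

The first inclusion holds because [eta] is the coding [phi 0].

Second inclusion. A measure [nu] on X_phi is lifted to an invariant measure
[rho] on the product of [H] with the full shift, carried by the closure of the
graph of [phi] ([invariant_lift]): for each [x] choose [h] whose coding agrees
with [x] on a long window, average along the orbit of the pair, and take an
ultralimit. The limit is only finitely additive, but on clopen sets this is
enough, by compactness ([content_extension]). The first marginal of [rho] is
rotation invariant, hence Haar ([invariant_saturated]). On the closure of the
graph, [x] lies between the codings of the interior of the window and of the
window itself. Regularity of [eta*] makes the difference between the interior
of the window and [window_reg] null ([window_boundary_null]); therefore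
[M_H (h, x) = x] almost surely, and [nu] is the image of the joining [rho].

Third inclusion. It is enough that for almost every [h] every [z] between
[phi_reg h] and [phi h] belongs to X_eta ([between_in_X_eta]), that is, each
finite pattern of [z] occurs in [eta]. For almost every [h] the elements of [H]
close to [h] that stay in the window at the ones of the pattern have positive
measure; so the integers that satisfy these conditions for the members of [B]
up to [K], and a congruence given by [h], have density at least [delta],
uniformly in [K]. If [phi h] has a one at [i] where [z] has a zero, then
[h + i] is outside [window_reg], and some [d] in [D] divides it
([not_window_reg_divisor]). Then [B] contains [d * a] with [a] coprime to any
given integer; asking that [d * a] divides [n + i] makes [i] a zero of the
pattern, and costs only a factor [a] in the density of the other conditions
([uniformly_dense_kill]). At the end all zeros are forced by a congruence, and
only the ones remain: the theorem of Davenport and Erdos, in the form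
[davenport_erdos_pattern], gives an integer that realises them for the whole
of [B] and not only for the members up to [K].

The Davenport-Erdos theorem rests on two facts. The sum of [1 / n] over the
[n <= x] divisible by some member of [B], but by none up to [K], is at most
[x! / totient x!] times the increase of the density of multiples between the
levels [K] and [x] ([harmonic_multiples_le]); and [x! / totient x!] is
[O (1 + ln x)] ([fact_le_totient]). *)

(** * Counting along periodic sets *)

Definition count_upto (P : pred nat) (q : nat) : nat :=
  (\sum_(1 <= u < q.+1) P u)%N.

Lemma count_upto_add (P : pred nat) (m n : nat) :
  count_upto P (m + n) = (count_upto P m + count_upto (fun u => P (m + u)) n)%N.
Proof.
rewrite /count_upto (@big_cat_nat _ _ _ m.+1)//=; last first.
  by rewrite ltnS leq_addr.
congr (_ + _)%N; rewrite -addnS -{1}[m.+1]add1n big_addn addKn.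
by apply: eq_big_nat => u _; rewrite addnC.
Qed.

Lemma count_upto_periodic (P : pred nat) (q m : nat) :
  (forall u, P (u + q)%N = P u) -> count_upto P (m * q) = (m * count_upto P q)%N.
Proof.
move=> Pq; elim: m => [|m IH]; first by rewrite !mul0n /count_upto big_geq.
rewrite !mulSn count_upto_add -IH; congr (_ + _)%N.
by apply: eq_big_nat => u _; rewrite addnC Pq.
Qed.

(** Each block of [n] consecutive integers contains exactly one multiple of [n]. *)
Lemma count_upto_multiples (n m : nat) (P : pred nat) : (0 < n)%N ->
  count_upto (fun u => (n %| u)%N && P (u %/ n)%N) (m * n) = count_upto P m.
Proof.
move=> n0; elim: m => [|m IH].
  by rewrite mul0n /count_upto !big_geq.
rewrite mulSn addnC count_upto_add IH /count_upto [RHS]big_nat_recr//=.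
congr (_ + _)%N; rewrite -{1}(prednK n0) big_nat_recr//= (prednK n0).
rewrite big_nat_cond big1 ?add0n; last first.
  move=> u /andP[/andP[u0 un] _].
  by rewrite dvdn_addr ?dvdn_mull// gtnNdvd.
by rewrite -mulSnr dvdn_mull//= mulnK.
Qed.

Lemma le_count_upto (P P' : pred nat) q :
  (forall u, P u -> P' u) -> (count_upto P q <= count_upto P' q)%N.
Proof.
by move=> PP'; apply: leq_sum => u _; case: (P u) (PP' u) => // ->.
Qed.

Lemma count_upto_le P q : (count_upto P q <= q)%N.
Proof.
rewrite /count_upto (@leq_trans (\sum_(1 <= u < q.+1) 1)%N)//.
  by apply: leq_sum => u _; case: (P u).
by rewrite sum_nat_const_nat subn1 muln1.
Qed.

Lemma count_coprime (Q m : nat) : (0 < Q)%N ->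
  count_upto (fun v => coprime v Q) (m * Q) = (m * totient Q)%N.
Proof.
move=> Q0; rewrite count_upto_periodic; last first.
  by move=> u; rewrite /coprime gcdnC gcdnDr gcdnC.
congr (_ * _)%N; rewrite totient_count_coprime /count_upto.
case: Q Q0 => // Q _; rewrite big_nat_recr//= [RHS]big_ltn// addnC.
congr (_ + _)%N; first by rewrite /coprime gcdnn gcdn0.
by apply: eq_bigr => i _; rewrite coprime_sym.
Qed.

Lemma logn_partn (pi : nat_pred) (p n : nat) :
  logn p n`_pi = if p \in pi then logn p n else 0%N.
Proof.
rewrite -logn_part -partnI; case: ifPn => ppi.
  rewrite -[RHS]logn_part; congr (logn _ _); apply: eq_partn => r.
  by rewrite !inE; case: eqP => [->|]; rewrite ?ppi ?andbF ?andbT.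
rewrite (@eq_partn _ (pred0 : nat_pred)); last first.
  by move=> r; rewrite !inE; case: eqP => [->|]; rewrite ?(negbTE ppi) ?andbF.
by rewrite /partn big_pred0// logn1.
Qed.

Section smooth_parts.
Variable R : realType.

Local Notation ln := (@ln R).

Lemma ln_natE (m n : nat) : (0 < n <= m)%N ->
  ln n%:R = \sum_(0 <= p < m.+1) (logn p n)%:R * ln p%:R.
Proof.
move=> /andP[n0 nm].
have := @widen_partn m predT n nm; rewrite partnT// => nE.
rewrite {1}nE; elim: m.+1 => [|k IH]; first by rewrite !big_geq// ln1.
rewrite !big_nat_recr//= natrM lnM.
- by rewrite IH natrX; congr (_ + _); case: k {IH} => [|k];
    [rewrite lognE /= expr0 ln1 mul0r|rewrite lnXn ?ltr0n// mulr_natl].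
- rewrite posrE ltr0n; apply: prodn_gt0 => p.
  by rewrite expn_gt0; case: p => // ; rewrite lognE.
- by rewrite posrE ltr0n expn_gt0; case: (k) => //; rewrite lognE.
Qed.

Lemma ln_nat_ge0 (n : nat) : 0 <= ln n%:R.
Proof.
case: n => [|n]; first by rewrite ln0.
by rewrite ln_ge0// ler1n.
Qed.

(** The increments satisfy [1 / (n + 1) <= ln (n + 1) - ln n], which is
[ln (1 - y) <= - y] at [y = 1 / (n + 1)]. *)
Lemma harmonic_le (n : nat) : (0 < n)%N ->
  \sum_(1 <= k < n.+1) (k%:R^-1 : R) <= 1 + ln n%:R.
Proof.
case: n => // n _; elim: n => [|n IH].
  by rewrite big_nat1 ln1 addr0 invr1.
rewrite big_nat_recr//= (le_trans (lerD IH (lexx _)))//.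
rewrite -addrA lerD2l.
have n0 : (0 : R) < n.+1%:R by rewrite ltr0n.
have n1 : (0 : R) < n.+2%:R by rewrite ltr0n.
have := @le_ln1Dx R (- n.+2%:R^-1).
rewrite ltrN2 invf_lt1// ltr1n => /(_ isT).
rewrite (_ : 1 - n.+2%:R^-1 = n.+1%:R / n.+2%:R); last first.
  by apply: (mulIf (lt0r_neq0 n1)); rewrite mulrBl mulVf ?lt0r_neq0// divfK
    ?lt0r_neq0// -[n.+2]addn1 natrD; ring.
rewrite ln_div ?posrE//.
move: (ln _) (ln _) (_^-1) => a b c; lra.
Qed.

Lemma harmonic_ge (n : nat) :
  ln n.+1%:R <= \sum_(1 <= k < n.+1) (k%:R^-1 : R).
Proof.
elim: n => [|n IH]; first by rewrite big_geq// ln1.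
rewrite big_nat_recr//= (le_trans _ (lerD IH (lexx _)))//.
have n0 : (0 : R) < n.+1%:R by rewrite ltr0n.
have n1 : (0 : R) < n.+2%:R by rewrite ltr0n.
have := @le_ln1Dx R (n.+1%:R^-1).
rewrite (lt_trans (ltrN10 _)) ?invr_gt0// => /(_ isT).
rewrite (_ : 1 + n.+1%:R^-1 = n.+2%:R / n.+1%:R); last first.
  by apply: (mulIf (lt0r_neq0 n0)); rewrite mulrDl mulVf ?lt0r_neq0// divfK
    ?lt0r_neq0// -[n.+2]addn1 natrD; ring.
rewrite ln_div ?posrE//.
move: (ln _) (ln _) (_^-1) => a b c; lra.
Qed.

(** The exponent of [p] in [x!] is at least [x / p] rounded down, hence at least
[x / (2 p)], while [ln x!] is at most [x ln x]. *)
Lemma sum_ln_prime_le (x : nat) : (0 < x)%N ->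
  \sum_(0 <= p < x.+1 | prime p) (ln p%:R / p%:R) <= 2 * ln x%:R.
Proof.
move=> x0; have xR : (0 : R) < x%:R by rewrite ltr0n.
have fact_le : ln (x`!)%:R <= x%:R * ln x%:R.
  rewrite fact_prod natr_prod mulr_natl -lnXn// ler_ln ?posrE ?exprn_gt0//; last first.
    by rewrite big_nat_cond prodr_gt0// => i /andP[/andP[i0 _] _]; rewrite ltr0n.
  rewrite (@le_trans _ _ (\prod_(1 <= i < x.+1) x%:R))//; last first.
    by rewrite prodr_const_nat subn1.
  rewrite big_nat_cond [leRHS]big_nat_cond ler_prod//.
  by move=> i /andP[/andP[i0 ix] _]; rewrite ler0n/= ler_nat -ltnS.
have lnE := @ln_natE x`! x`! _.
rewrite fact_gt0 leqnn in lnE; have {lnE} := lnE isT.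
move=> lnE.
have half : x%:R / 2 * (\sum_(0 <= p < x.+1 | prime p) (ln p%:R / p%:R)) <= ln (x`!)%:R.
  have xle : (x.+1 <= x`!.+1)%N by rewrite ltnS fact_geq.
  rewrite lnE [leRHS](@big_cat_nat _ _ _ x.+1 0)//=.
  rewrite mulr_sumr -[leLHS]addr0 lerD//; last first.
    by apply: sumr_ge0 => i _; rewrite mulr_ge0 ?ler0n ?ln_nat_ge0.
  rewrite big_mkcond/=; apply: ler_sum_nat => p /andP[_ px].
  case: ifPn => pp; last by rewrite mulr_ge0 ?ler0n ?ln_nat_ge0.
  rewrite mulrCA mulrC ler_wpM2r ?ln_nat_ge0//.
  have p0 : (0 < p)%N by exact: prime_gt0.
  have : (x %/ p <= logn p x`!)%N.
    by rewrite logn_fact// big_ltn// expn1 leq_addr.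
  rewrite -(ler_nat R); apply: le_trans.
  rewrite ler_pdivrMr ?ltr0n// ler_pdivrMr// -natrM -natrM ler_nat.
  have := divn_eq x p; have := ltn_pmod x p0; rewrite ltnS in px.
  have : (0 < x %/ p)%N by rewrite divn_gt0.
  nia.
have := le_trans half fact_le.
rewrite -mulrA ler_pM2l//; lra.
Qed.

Lemma sum_pow_inv_le (p K : nat) : (1 < p)%N ->
  \sum_(1 <= k < K.+1) (p ^ k)%:R^-1 <= 2 / p%:R :> R.
Proof.
move=> p1; have p0 : (0 : R) < p%:R by rewrite ltr0n ltnW.
have p2 : (2 : R) <= p%:R by rewrite ler_nat.
suff : \sum_(1 <= k < K.+1) (p ^ k)%:R^-1 <= 2 / p%:R - (2 / p%:R) * (p ^ K)%:R^-1 :> R.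
  by move/le_trans; apply; rewrite gerBl !mulr_ge0// invr_ge0 ?ler0n.
elim: K => [|K IH]; first by rewrite big_geq// expn0 invr1 mulr1 subrr.
rewrite big_nat_recr//= (le_trans (lerD IH (lexx _)))//.
rewrite -addrA lerD2l expnS natrM invfM.
set y := (p ^ K)%:R^-1; have y0 : 0 <= y by rewrite invr_ge0 ler0n.
rewrite [2 / _]mulrC.
have ip : p%:R^-1 <= 2^-1 :> R by rewrite lef_pV2 ?posrE.
have ip0 : 0 < p%:R^-1 :> R by rewrite invr_gt0.
move: ip ip0; set z := p%:R^-1 => ip ip0.
have : 0 <= z * y * (2^-1 - z) by rewrite !mulr_ge0 ?subr_ge0// ltW.
lra.
Qed.

Definition smooth_part (x n : nat) : nat := (n`_[pred p | (p <= x)%N])%N.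

(** Summing over [u <= q] the exponents of [p] gives the exponent of [p] in [q!],
which is at most [q] times the sum of the [1 / p ^ k], hence at most [2 q / p].
So the logarithm of the smooth part has mean at most [4 ln x]. *)
Lemma sum_ln_smooth_part (x q : nat) : (0 < x)%N ->
  \sum_(1 <= u < q.+1) ln (smooth_part x u)%:R <= 4 * q%:R * ln x%:R.
Proof.
move=> x0.
have smE u : (0 < u <= q)%N ->
    ln (smooth_part x u)%:R = \sum_(0 <= p < x.+1) (logn p u)%:R * ln p%:R.
  move=> /andP[u0 uq].
  have le1 : (smooth_part x u <= u)%N by exact: dvdn_leq (dvdn_part _ _).
  rewrite (@ln_natE (q + x)); last first.
    by rewrite part_gt0/= (leq_trans le1)// (leq_trans uq)// leq_addr.
  rewrite (@big_cat_nat _ _ _ x.+1)//= ?ltnS ?leq_addl//.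
  rewrite [X in _ + X]big_nat_cond [X in _ + X]big1 ?addr0; last first.
    move=> p /andP[/andP[xp _] _].
    by rewrite /smooth_part logn_partn inE leqNgt xp mul0r.
  apply: eq_big_nat => p /andP[_ px].
  by rewrite /smooth_part logn_partn inE -ltnS px.
rewrite big_nat_cond (eq_bigr (fun u => \sum_(0 <= p < x.+1) (logn p u)%:R * ln p%:R));
  last by move=> u /andP[/andP[u0 uq] _]; rewrite smE// u0 -ltnS.
rewrite -big_nat_cond exchange_big/=.
have term p : (p < x.+1)%N -> \sum_(1 <= u < q.+1) (logn p u)%:R * ln p%:R <=
    if prime p then 2 * q%:R * (ln p%:R / p%:R) else 0.
  move=> px; case: ifPn => pp; last first.
    rewrite big1// => u _; rewrite lognE (negbTE pp)/= mul0r//.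
  rewrite -mulr_suml mulrCA mulrC ler_wpM2l ?ln_nat_ge0//.
  have -> : \sum_(1 <= u < q.+1) (logn p u)%:R = (logn p q`!)%:R :> R.
    elim: q {smE} => [|q IH]; first by rewrite big_geq// fact0 logn1.
    by rewrite big_nat_recr//= IH factS lognM// ?fact_gt0// natrD addrC.
  rewrite logn_fact// natr_sum.
  apply: le_trans (_ : \sum_(1 <= k < q.+1) q%:R * (p ^ k)%:R^-1 <= _); last first.
    rewrite -mulr_sumr -mulrA mulrCA ler_wpM2l ?ler0n//.
    exact: sum_pow_inv_le (prime_gt1 pp).
  apply: ler_sum_nat => k _.
  rewrite ler_pdivlMr ?ltr0n ?expn_gt0 ?prime_gt0//.
  by rewrite -natrM ler_nat leq_divM.
apply: le_trans (_ : \sum_(0 <= p < x.+1 | prime p)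
    2 * q%:R * (ln p%:R / p%:R) <= _).
  by rewrite [leRHS]big_mkcond/=; apply: ler_sum_nat => p /andP[_ px]; exact: term.
rewrite -mulr_sumr.
have := sum_ln_prime_le x0.
move/(@ler_wpM2l R (2 * q%:R)); rewrite mulr_ge0 ?ler0n// => /(_ isT).
by move/le_trans; apply; rewrite mulrA (_ : 2 * q%:R * 2 = 4 * q%:R)//; ring.
Qed.

End smooth_parts.

(** * The totient of a factorial *)

Lemma fact_pnat (x : nat) : ([pred p | (p <= x)%N] : nat_pred).-nat x`!.
Proof.
elim: x => [|x IH]; first by rewrite fact0.
rewrite factS pnatM; apply/andP; split.
  apply/pnatP => // p pp pdx; rewrite inE; exact: dvdn_leq.
apply: sub_in_pnat IH => p _; rewrite !inE => /leq_trans; exact.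
Qed.

Lemma smooth_part_coprime (x u : nat) : (0 < u)%N ->
  [/\ (0 < smooth_part x u)%N, (smooth_part x u %| u)%N &
      coprime (u %/ smooth_part x u) x`!].
Proof.
move=> u0; split; [exact: part_gt0|exact: dvdn_part|].
rewrite -{1}(partnC [pred p | (p <= x)%N] u0) mulKn ?part_gt0//.
by rewrite coprime_sym; apply: pnat_coprime (fact_pnat x) (part_pnat _ _).
Qed.

Section totient_bound.
Variable R : realType.
Local Notation ln := (@ln R).

Lemma count_upto_natr (P : pred nat) q :
  (count_upto P q)%:R = \sum_(1 <= u < q.+1) ((P u)%:R : R).
Proof. by rewrite /count_upto natr_sum. Qed.

(** At least half of the integers up to [q] have an [x]-smooth part [n <= x ^ 8],
by Markov's inequality and [sum_ln_smooth_part]. Each such integer is [n v] with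
[v] coprime to [x!], and these have proportion [totient x! / (n x!)]. Summing
over [n] gives [1 / 2 <= totient x! / x! * (1 + 8 ln x)]. *)
Lemma fact_le_totient (x : nat) : (0 < x)%N ->
  x`!%:R <= (2 + 16 * ln x%:R) * (totient x`!)%:R.
Proof.
move=> x0; have [x1|x1] := leqP x 1.
  have -> : x = 1%N by apply/eqP; rewrite eqn_leq x1.
  by rewrite ln1 mulr0 addr0 (_ : totient _ = 1%N)// mulr1 ler_nat.
have lnx : 0 < ln x%:R by rewrite ln_gt0// ltr1n.
set Q := x`!; have Q0 : (0 < Q)%N by exact: fact_gt0.
pose Y := (x ^ 8)%N; have Y0 : (0 < Y)%N by rewrite expn_gt0 x0.
(* This [q] is a multiple of [n Q] for every [n <= Y], so that the integers
   coprime to [Q] are counted exactly. *)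
pose q := (Y`! * Q)%N; have q0 : (0 < q)%N by rewrite muln_gt0 fact_gt0.
have lnY : ln Y%:R = 8 * ln x%:R by rewrite natrX lnXn ?ltr0n// mulr_natl.
pose good u := (smooth_part x u <= Y)%N.
(* Markov's inequality for the logarithm of the smooth part *)
have markov : q%:R <= 2 * (count_upto good q)%:R :> R.
  have bad : 8 * ln x%:R * (count_upto (fun u => ~~ good u) q)%:R <= 4 * q%:R * ln x%:R.
    apply: le_trans (sum_ln_smooth_part R q x0).
    rewrite count_upto_natr mulr_sumr; apply: ler_sum_nat => u _.
    rewrite /good; case: leqP => uY /=; first by rewrite mulr0 ln_nat_ge0.
    rewrite mulr1 -lnY ler_ln ?posrE ?ltr0n// ?ler_nat; first exact: ltnW.
    exact: leq_ltn_trans uY.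
  have tot : (count_upto good q + count_upto (fun u => ~~ good u) q)%N = q.
    rewrite /count_upto -big_split/= -[RHS]muln1 -[q in RHS](subn1 q.+1).
    rewrite -sum_nat_const_nat; apply: eq_bigr => u _; by case: (good u).
  have totR : (count_upto good q)%:R + (count_upto (fun u => ~~ good u) q)%:R = q%:R :> R.
    by rewrite -natrD tot.
  rewrite (_ : 4 * q%:R * ln x%:R = ln x%:R * (4 * q%:R)) in bad; last by ring.
  rewrite mulrAC mulrC ler_pM2l// in bad.
  lra.
have cover : (count_upto good q)%:R <= Y`!%:R * (totient Q)%:R * \sum_(1 <= n < Y.+1) (n%:R^-1 : R).
  apply: le_trans (_ : \sum_(1 <= n < Y.+1) \sum_(1 <= u < q.+1)
    ((n %| u)%N && coprime (u %/ n) Q)%:R <= _).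
    rewrite exchange_big/= count_upto_natr; apply: ler_sum_nat => u /andP[u0 _].
    rewrite /good; case: leqP => [uY|_]; last by apply: sumr_ge0.
    have [s0 sd sc] := smooth_part_coprime x u0.
    rewrite (bigD1_seq (smooth_part x u)) ?iota_uniq ?mem_index_iota ?s0//=.
    rewrite sd sc ler_wpDr//; exact: sumr_ge0.
  rewrite mulr_sumr; apply: ler_sum_nat => n /andP[n0 nY].
  rewrite -count_upto_natr.
  have nf : (n %| Y`!)%N by apply: dvdn_fact; rewrite n0.
  have -> : q = (Y`! %/ n * Q * n)%N by rewrite mulnAC divnK.
  rewrite (@count_upto_multiples n _ (fun v => coprime v Q))// count_coprime//.
  rewrite natrM mulrAC ler_wpM2r// ler_pdivlMr ?ltr0n// -natrM ler_nat.
  exact: leq_divM.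
have := le_trans markov (ler_wpM2l (ler0n R 2) cover).
rewrite natrM; set f := Y`!%:R; have f0 : 0 < f by rewrite ltr0n fact_gt0.
rewrite (_ : 2 * _ = f * (2 * (totient Q)%:R * \sum_(1 <= n < Y.+1) (n%:R^-1 : R))); last by ring.
rewrite ler_pM2l// => /le_trans; apply.
rewrite -mulrA mulrCA mulrC ler_wpM2r ?ler0n//.
have := @harmonic_le R _ Y0; rewrite lnY.
lra.
Qed.

End totient_bound.

(** * The theorem of Davenport and Erdos for patterns *)

Lemma sum_nat_shift (V : nmodType) (a b t : nat) (F : nat -> V) :
  \sum_(a + t <= n < b + t) F n = \sum_(a <= n < b) F (n + t)%N.
Proof. by rewrite big_addn addnK. Qed.

Section periodic.
Variables (R : realType) (P : pred nat).

Lemma periodic_mul q k : (forall u, P (u + q)%N = P u) ->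
  forall u, P (u + k * q)%N = P u.
Proof.
by move=> Pq; elim: k => [|k IH] u; rewrite ?addn0// mulSn addnA IH Pq.
Qed.

Lemma count_upto_cross q q' : (forall u, P (u + q)%N = P u) ->
  (forall u, P (u + q')%N = P u) ->
  (count_upto P q * q' = count_upto P q' * q)%N.
Proof.
move=> Pq Pq'; rewrite mulnC -count_upto_periodic// mulnC.
by rewrite count_upto_periodic// mulnC.
Qed.

(** The density of a periodic set does not depend on the period used to compute
it. *)
Lemma count_upto_ratio q q' : (0 < q)%N -> (0 < q')%N ->
  (forall u, P (u + q)%N = P u) -> (forall u, P (u + q')%N = P u) ->
  (count_upto P q)%:R / q%:R = (count_upto P q')%:R / q'%:R :> R.
Proof.
move=> q0 q'0 Pq Pq'; apply/eqP; rewrite eqr_div ?pnatr_eq0 -?lt0n//.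
by rewrite -!natrM (count_upto_cross Pq Pq').
Qed.

(** Harmonic weights decrease, so in each period the weights are at least the
last one. *)
Lemma periodic_harmonic_ge q m : (0 < q)%N -> (forall u, P (u + q)%N = P u) ->
  (count_upto P q)%:R / q%:R * \sum_(1 <= k < m.+1) (k%:R^-1 : R) <=
  \sum_(1 <= n < (m * q).+1) (P n)%:R / n%:R.
Proof.
move=> q0 Pq; elim: m => [|m IH]; first by rewrite mul0n !big_geq// mulr0.
rewrite big_nat_recr//= mulrDr.
rewrite [leRHS](@big_cat_nat _ _ _ (m * q).+1)//=; last first.
  by rewrite ltnS leq_mul2r leqnSn orbT.
rewrite lerD// mulSn -addSn -[(m * q).+1]add1n sum_nat_shift.
rewrite -mulrA -invfM -natrM count_upto_natr mulr_suml.
apply: ler_sum_nat => u /andP[u0 uq]; rewrite periodic_mul//.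
rewrite ler_wpM2l// lef_pV2 ?posrE ?ltr0n ?addn_gt0 ?u0// ?muln_gt0 ?q0//.
by rewrite ler_nat mulnS mulnC leq_add2r.
Qed.

End periodic.

Section multiples.
Variables (R : realType) (B : set nat).
Hypothesis B_pos : forall b, B b -> (0 < b)%N.

Definition dvd_upto (K n : nat) : bool :=
  `[< exists b, [/\ B b, (b <= K)%N & (b %| n)%N] >].

Lemma dvd_upto_periodic K q : (forall b, B b -> (b <= K)%N -> (b %| q)%N) ->
  forall u, dvd_upto K (u + q) = dvd_upto K u.
Proof.
move=> qK u; apply: asbool_equiv_eq; split=> -[b [Bb bK bu]]; exists b; split => //.
- by rewrite -(dvdn_addl _ (qK _ Bb bK)).
- by rewrite dvdn_addl// qK.
Qed.

Lemma dvd_fact b K : B b -> (b <= K)%N -> (b %| K`!)%N.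
Proof. by move=> Bb bK; apply: dvdn_fact; rewrite B_pos. Qed.

Lemma dvd_upto_sub K L n : (K <= L)%N -> dvd_upto K n -> dvd_upto L n.
Proof.
by move=> KL /asboolP[b [Bb bK bn]]; apply/asboolP; exists b; split => //;
  exact: leq_trans KL.
Qed.

Definition multiples_density (K : nat) : R :=
  (count_upto (dvd_upto K) K`!)%:R / K`!%:R.

Lemma multiples_densityE K q : (0 < q)%N ->
  (forall b, B b -> (b <= K)%N -> (b %| q)%N) ->
  multiples_density K = (count_upto (dvd_upto K) q)%:R / q%:R.
Proof.
move=> q0 qK; apply: count_upto_ratio => //; first exact: fact_gt0.
  by apply: dvd_upto_periodic => b; exact: dvd_fact.
exact: dvd_upto_periodic.
Qed.

Lemma multiples_density_fact K x : (K <= x)%N ->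
  multiples_density K = (count_upto (dvd_upto K) x`!)%:R / x`!%:R.
Proof.
move=> Kx; apply: multiples_densityE; first exact: fact_gt0.
by move=> b Bb bK; apply: dvd_fact => //; exact: leq_trans Kx.
Qed.

Lemma multiples_density_nondecreasing K x : (K <= x)%N ->
  multiples_density K <= multiples_density x.
Proof.
move=> Kx; rewrite (multiples_density_fact Kx) ler_wpM2r ?invr_ge0//.
by rewrite ler_nat; apply: le_count_upto => u; exact: dvd_upto_sub.
Qed.

(** A bounded nondecreasing sequence has increments that are eventually small. *)
Lemma multiples_density_tail (e : R) : 0 < e ->
  exists K, forall x, (K <= x)%N -> multiples_density x - multiples_density K <= e.
Proof.
move=> e0; apply: contrapT => /forallNP nK.
have step K : exists x, (K <= x)%N /\ e < multiples_density x - multiples_density K.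
  have /existsNP[x /not_implyP[Kx /negP]] := nK K.
  by rewrite -ltNge => ?; exists x.
have {step} iterate k : exists x, e * k%:R <= multiples_density x.
  elim: k => [|k [x xk]].
    by exists 0%N; rewrite mulr0 divr_ge0.
  have [y [xy exy]] := step x; exists y.
  rewrite -addn1 natrD mulrDr mulr1; lra.
have [x] := iterate (Num.truncn (e^-1)).+1.
have le1 : multiples_density x <= 1.
  by rewrite ler_pdivrMr ?ltr0n ?fact_gt0// mul1r ler_nat count_upto_le.
move=> /le_trans /(_ le1); rewrite mulrC -ler_pdivlMr// mul1r leNgt.
by rewrite truncnS_gt.
Qed.

(** For [n <= x] let [S n] be the set of the [n v] with [v] coprime to [x!]. Since
[n] divides [x!], the sets [S n] are pairwise disjoint; an element of [S n] is
divisible by a member of [B] up to [K] exactly when [n] is. So the [S n], for [n]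
counted on the left, are disjoint parts of the set of the multiples of members
up to [x], but of none up to [K]. The density of [S n] is
[totient x! / (n x!)]. *)
Lemma harmonic_multiples_le (K x : nat) : (0 < x)%N -> (K <= x)%N ->
  (\sum_(1 <= n < x.+1) (dvd_upto x n && ~~ dvd_upto K n)%:R / n%:R) *
    (totient x`!)%:R <=
  x`!%:R * (multiples_density x - multiples_density K).
Proof.
move=> x0 Kx; set Q := x`!; have Q0 : (0 < Q)%N by exact: fact_gt0.
have QR : (0 : R) < Q%:R by rewrite ltr0n.
pose A u := dvd_upto x u && ~~ dvd_upto K u.
have dx b : B b -> (b <= x)%N -> (b %| Q)%N by exact: dvd_fact.
have dK b : B b -> (b <= K)%N -> (b %| Q)%N.
  by move=> Bb bK; apply: dvd_fact => //; exact: leq_trans Kx.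
have -> : Q%:R * (multiples_density x - multiples_density K) = (count_upto A Q)%:R :> R.
  rewrite (multiples_density_fact Kx) /multiples_density -mulrBl mulrC divfK ?gt_eqF//.
  rewrite !count_upto_natr -sumrB; apply: eq_bigr => u _; rewrite /A.
  have := @dvd_upto_sub K x u Kx.
  by case: (dvd_upto K u) => [->//|_]; rewrite ?subrr ?andbT ?subr0.
have Aper u : A (u + Q)%N = A u by rewrite /A !dvd_upto_periodic.
have cAQ : (count_upto A (Q * Q))%:R = Q%:R * (count_upto A Q)%:R :> R.
  by rewrite count_upto_periodic// natrM.
rewrite -(ler_pM2l QR) -cAQ mulr_suml mulr_sumr.
apply: le_trans (_ : \sum_(1 <= n < x.+1) \sum_(1 <= u < (Q * Q).+1)
    (A n && ((n %| u)%N && coprime (u %/ n) Q))%:R <= _).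
  apply: ler_sum_nat => n /andP[n0 nx].
  have nQ : (n %| Q)%N by apply: dvdn_fact; rewrite n0.
  rewrite /A; case: (_ && _) => /=; last first.
    by rewrite !mul0r mulr0; apply: sumr_ge0.
  rewrite -count_upto_natr.
  have -> : (Q * Q = Q %/ n * Q * n)%N by rewrite mulnAC divnK.
  rewrite (@count_upto_multiples n _ (fun v => coprime v Q))// count_coprime//.
  rewrite natrM mulrA ler_wpM2r// mul1r ler_pdivrMr ?ltr0n// -natrM ler_nat.
  by rewrite divnK.
(* An integer [u] belongs to at most one of the sets [S n]. *)
rewrite exchange_big/= count_upto_natr; apply: ler_sum_nat => u /andP[u0 _].
have [/hasP[n]|/hasPn none] := boolP (has (fun n => A n && ((n %| u)%N && coprime (u %/ n) Q))
    (index_iota 1 x.+1)); last first.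
  rewrite big_seq_cond big1// => n /andP[nx _].
  by have /negbTE -> := none _ nx.
rewrite mem_index_iota => /andP[n0 nx] /and3P[An nu cu].
have nQ : (n %| Q)%N by apply: dvdn_fact; rewrite n0.
have Au : A u.
  move: An => /andP[/asboolP[b [Bb bx bn]] /asboolPn nK]; apply/andP; split.
    by apply/asboolP; exists b; split => //; exact: dvdn_trans nu.
  apply/asboolPn => -[c [Bc cK]]; rewrite -(divnK nu) Gauss_dvdr; last first.
    by rewrite coprime_sym; apply: coprime_dvdr (dK _ Bc cK) cu.
  by move=> cn; apply: nK; exists c.
rewrite Au (bigD1_seq n) ?iota_uniq ?mem_index_iota ?n0//=.
rewrite big_seq_cond big1 ?addr0; first by case: (_ && _).
move=> k /andP[]; rewrite mem_index_iota => /andP[k0 kx] kn.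
case: (boolP (_ && _)) => // /and3P[_ ku ck].
have kQ : (k %| Q)%N by apply: dvdn_fact; rewrite k0.
have E : (u %/ n * n = u %/ k * k)%N by rewrite !divnK.
case/eqP: kn; apply/eqP; rewrite eqn_dvd; apply/andP; split.
- rewrite -(@Gauss_dvdr _ (u %/ n)) ?E ?dvdn_mull//.
  by rewrite coprime_sym; apply: coprime_dvdr kQ cu.
- rewrite -(@Gauss_dvdr _ (u %/ k)) -?E ?dvdn_mull//.
  by rewrite coprime_sym; apply: coprime_dvdr nQ ck.
Qed.

Lemma harmonic_tail_le (K x : nat) : (0 < x)%N -> (K <= x)%N ->
  \sum_(1 <= n < x.+1) (dvd_upto x n && ~~ dvd_upto K n)%:R / n%:R <=
  (2 + 16 * ln x%:R) * (multiples_density x - multiples_density K).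
Proof.
move=> x0 Kx.
have t0 : (0 : R) < (totient x`!)%:R by rewrite ltr0n totient_gt0 fact_gt0.
rewrite -(ler_pM2r t0) (le_trans (harmonic_multiples_le x0 Kx))//.
rewrite mulrAC ler_wpM2r ?fact_le_totient//.
by rewrite subr_ge0 multiples_density_nondecreasing.
Qed.

(** Suppose that no integer realises the pattern. Choose [K] such that the
density of multiples increases by a small multiple of [delta] after [K]. Every
integer [n <= x] with the pattern truncated at [K] has some [n + t] that is a
multiple of a member of [B] but of none up to [K]. The sum of [1 / n] over the
former is at least [delta ln x] up to a constant, and over the latter it is a
small multiple of [delta (1 + ln x)]. *)
Lemma davenport_erdos_pattern (M : nat) (P : pred nat) (T : seq nat) (delta : R) :
  (0 < M)%N -> (forall u, P (u + M)%N = P u) -> 0 < delta ->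
  (forall K q, (0 < q)%N -> (M %| q)%N ->
     (forall b, B b -> (b <= K)%N -> (b %| q)%N) ->
     delta * q%:R <=
     (count_upto (fun n => P n && all (fun t => ~~ dvd_upto K (n + t)) T) q)%:R) ->
  exists n, P n /\ forall t b, t \in T -> B b -> ~~ (b %| n + t)%N.
Proof.
move=> M0 PM delta0 hyp; apply: contrapT => /forallNP none.
have killed n : P n -> exists t b, [/\ t \in T, B b & (b %| n + t)%N].
  move=> Pn; have := none n; apply: contra_notP => /forallNP h; split => // t b tT Bb.
  by apply/negP => bn; apply: (h t); exists b.
pose S := sumn T; pose c : R := (size T * S.+1).+1%:R.
have c0 : 0 < c by rewrite ltr0n.
have TS t : t \in T -> (t <= S)%N.
  rewrite /S; elim: T {hyp none killed S c c0} => //= a s IH; rewrite inE.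
  by case/orP=> [/eqP ->|/IH /leq_trans]; [exact: leq_addr|apply; exact: leq_addl].
have [K Ktail] := @multiples_density_tail (delta / (100 * c)) (divr_gt0 delta0 (mulr_gt0 (ltr0n _ 100) c0)).
pose q := (M * K`!)%N; have q0 : (0 < q)%N by rewrite muln_gt0 M0 fact_gt0.
pose G n := P n && all (fun t => ~~ dvd_upto K (n + t)) T.
have qK b : B b -> (b <= K)%N -> (b %| q)%N.
  by move=> Bb bK; apply: dvdn_mull; exact: dvd_fact.
have Gq u : G (u + q)%N = G u.
  rewrite /G /q mulnC periodic_mul//; congr (_ && _).
  by apply: eq_all => t; rewrite addnAC mulnC dvd_upto_periodic.
have dens : delta * q%:R <= (count_upto G q)%:R.
  by apply: hyp => //; exact: dvdn_mulr.
(* With this choice [X <= (m + 1) ^ 2], so [ln X] and [ln (m + 1)] are comparable. *)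
pose m := (q + S)%N; pose x := (m * q)%N; pose X := (x + S)%N.
have m0 : (0 < m)%N by rewrite addn_gt0 q0.
have Kq : (K <= q)%N.
  by rewrite (leq_trans (fact_geq K))// leq_pmull.
have xX : (x <= X)%N by exact: leq_addr.
have qx : (q <= x)%N by rewrite leq_pmull.
have KX : (K <= X)%N by rewrite (leq_trans Kq)// (leq_trans qx).
have X0 : (0 < X)%N by rewrite (leq_trans q0)// (leq_trans qx).
have lower : delta * ln m.+1%:R <= \sum_(1 <= n < x.+1) ((G n)%:R / n%:R : R).
  apply: le_trans (periodic_harmonic_ge R m q0 Gq).
  apply: le_trans (_ : delta * \sum_(1 <= k < m.+1) (k%:R^-1 : R) <= _).
    by rewrite ler_pM2l// harmonic_ge.
  rewrite ler_wpM2r//; first by apply: sumr_ge0 => i _; rewrite invr_ge0.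
  by rewrite ler_pdivlMr ?ltr0n.
pose A n := dvd_upto X n && ~~ dvd_upto K n.
have sumA : \sum_(1 <= n < X.+1) ((A n)%:R / n%:R : R) <=
    (2 + 16 * ln X%:R) * (delta / (100 * c)).
  apply: le_trans (harmonic_tail_le X0 KX) _.
  by rewrite ler_wpM2l ?Ktail// addr_ge0// mulr_ge0// ln_nat_ge0.
have term n t : (1 <= n < x.+1)%N -> t \in T ->
    (A (n + t)%N)%:R / n%:R <= S.+1%:R * ((A (n + t)%N)%:R / (n + t)%:R) :> R.
  move=> /andP[n0 nx] tT; rewrite mulrCA ler_wpM2l//.
  rewrite ler_pdivlMr ?ltr0n ?addn_gt0 ?n0// mulrC ler_pdivrMr ?ltr0n//.
  rewrite -natrM ler_nat mulSn leq_add2l (leq_trans (TS _ tT))//.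
  by rewrite leq_pmulr.
have shift t : t \in T -> \sum_(1 <= n < x.+1) ((A (n + t)%N)%:R / (n + t)%:R : R) <=
    \sum_(1 <= n < X.+1) ((A n)%:R / n%:R : R).
  move=> tT; have tS := TS _ tT.
  have h1 : (1 + t <= x.+1 + t)%N by rewrite leq_add2r.
  have h2 : (x.+1 + t <= X.+1)%N by rewrite addSn ltnS leq_add2l.
  rewrite -(sum_nat_shift _ _ _ (fun k => (A k)%:R / k%:R : R)).
  rewrite [leRHS](@big_cat_nat _ _ _ (1 + t))//=; last exact: leq_trans h2.
  rewrite [X in _ <= _ + X](@big_cat_nat _ _ _ (x.+1 + t))//= addrCA lerDl.
  by rewrite addr_ge0//; apply: sumr_ge0 => i _; rewrite divr_ge0.
have upper : \sum_(1 <= n < x.+1) ((G n)%:R / n%:R : R) <=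
    (size T)%:R * S.+1%:R * \sum_(1 <= n < X.+1) ((A n)%:R / n%:R : R).
  apply: le_trans (_ : \sum_(1 <= n < x.+1) \sum_(t <- T)
      S.+1%:R * ((A (n + t)%N)%:R / (n + t)%:R) <= _).
    apply: ler_sum_nat => n nx.
    have nonneg : 0 <= \sum_(t <- T) S.+1%:R * ((A (n + t)%N)%:R / (n + t)%:R) :> R.
      by apply: sumr_ge0 => t _; rewrite mulr_ge0// divr_ge0.
    case: (boolP (G n)) => [/andP[Pn /allP nK]|_]; last by rewrite mul0r.
    have [t [b [tT Bb bnt]]] := killed _ Pn.
    have At : A (n + t)%N.
      rewrite /A nK// andbT; apply/asboolP; exists b; split => //.
      have /andP[n0 nxx] := nx.
      have : (b <= n + t)%N by apply: dvdn_leq => //; rewrite addn_gt0 n0.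
      by move/leq_trans; apply; apply: leq_add => //; exact: TS.
    apply: le_trans (_ : S.+1%:R * ((A (n + t)%N)%:R / (n + t)%:R) <= _).
      by have := term _ _ nx tT; rewrite At.
    rewrite (big_rem t)//= lerDl.
    by apply: sumr_ge0 => k _; rewrite mulr_ge0// divr_ge0.
  rewrite exchange_big/=.
  apply: le_trans (_ : \sum_(t <- T) S.+1%:R *
      \sum_(1 <= n < X.+1) ((A n)%:R / n%:R : R) <= _).
    rewrite big_seq [leRHS]big_seq; apply: ler_sum => t tT.
    by rewrite -mulr_sumr ler_wpM2l// shift.
  by rewrite big_const_seq count_predT iter_addr_0 -[leLHS]mulr_natl mulrA.
have XL : ln X%:R <= 2 * ln m.+1%:R :> R.
  rewrite mulr_natl -lnXn ?ltr0n// ler_ln ?posrE ?exprn_gt0 ?ltr0n// -natrX ler_nat.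
  rewrite /X /x /m; nia.
have L0 : 2^-1 <= ln m.+1%:R :> R.
  have := @harmonic_le R 2 isT.
  rewrite big_nat_recr//= big_nat1 invr1 lerD2l => /le_trans; apply.
  by rewrite ler_ln ?posrE ?ltr0n// ler_nat.
have := le_trans lower upper.
have a0 : (0 : R) <= (size T)%:R * S.+1%:R by rewrite mulr_ge0.
move=> /le_trans /(_ (ler_wpM2l a0 sumA)).
have ac : (size T)%:R * S.+1%:R <= c by rewrite -natrM ler_nat.
move: a0 ac; set a := _ * _ => a0 ac.
rewrite (_ : a * _ = delta * (a / c * ((2 + 16 * ln X%:R) / 100))); last first.
  by rewrite invfM; ring.
rewrite ler_pM2l// => h.
have ac1 : a / c <= 1 by rewrite ler_pdivrMr// mul1r.
have Y0 : 0 <= (2 + 16 * ln X%:R) / 100 :> R.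
  by rewrite divr_ge0// addr_ge0// mulr_ge0// ln_nat_ge0.
have := le_trans h (ler_wpM2r Y0 ac1).
move: XL L0; move: (ln m.+1%:R) (ln X%:R) => L LX; lra.
Qed.

End multiples.

(** * Coprime families of dilations *)

Lemma common_prime (m n : nat) : (0 < n)%N -> ~~ coprime m n ->
  exists p, [/\ prime p, (p %| m)%N & (p %| n)%N].
Proof.
move=> n0 ncop; exists (pdiv (gcdn m n)).
have g1 : (1 < gcdn m n)%N by rewrite ltn_neqAle eq_sym ncop gcdn_gt0 n0 orbT.
split; first exact: pdiv_prime.
- exact: dvdn_trans (pdiv_dvd _) (dvdn_gcdl _ _).
- exact: dvdn_trans (pdiv_dvd _) (dvdn_gcdr _ _).
Qed.

(** A number that is [u] modulo [m], and [1] modulo the part of [X] made of the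
primes that do not divide [m], shares no prime with [X]. It serves as
a substitute for a prime of the progression. *)
Lemma coprime_in_progression (u : int) (m X : nat) : (0 < m)%N -> (0 < X)%N ->
  coprime (absz u) m -> exists k : int, coprime (absz (u + m%:Z * k)) X.
Proof.
move=> m0 X0 um; pose X2 := (X`_(\pi(m)^'))%N.
have X20 : (0 < X2)%N by exact: part_gt0.
have mX2 : coprimez m%:Z X2%:Z.
  rewrite coprimezE/=; apply: (@pnat_coprime \pi(m)); last exact: part_pnat.
  exact: pnat_pi.
pose v := zchinese m%:Z X2%:Z u 1.
have /eqP := zchinese_modl mX2 u 1; rewrite eqz_mod_dvd => /dvdzP[k vE].
have /eqP := zchinese_modr mX2 u 1; rewrite eqz_mod_dvd => v1.
exists k; rewrite mulrC -vE addrC subrK -/v.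
apply: contrapT => /negP /(common_prime X0)[p [pp pv pX]].
have pvz : (p%:Z %| v)%Z by rewrite dvdzE.
have [pm|pm] := boolP (p %| m)%N.
  have pu : (p %| absz u)%N.
    have -> : u = v - k * m%:Z by rewrite -vE opprB addrC subrK.
    by rewrite -[(_ %| _)%N]/(p%:Z %| _)%Z rpredB// dvdz_mull// dvdzE.
  have : (p %| gcdn (absz u) m)%N by rewrite dvdn_gcd pu.
  by move: um => /eqP ->; rewrite dvdn1 => /eqP p1; rewrite p1 in pp.
have pX2 : (p %| X2)%N.
  have : p \in \pi(X2) by rewrite pi_of_part// !inE mem_primes pp X0 pX mem_primes pp m0.
  by rewrite mem_primes => /and3P[].
have : (p%:Z %| 1)%Z.
  have -> : 1 = v - (v - 1) :> int by rewrite opprB addrC subrK.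
  by rewrite rpredB//; apply: dvdz_trans v1; rewrite dvdzE.
by rewrite dvdzE /= dvdn1 => /eqP p1; rewrite p1 in pp.
Qed.

(** Choose the members one after the other, each coprime to all earlier ones;
they are distinct because they exceed [1]. *)
Lemma coprime_extraction (P : nat -> Prop) :
  (forall L, exists w, [/\ (1 < w)%N, P w &
     forall w', (w' <= L)%N -> P w' -> coprime w w']) ->
  exists A : set nat, [/\ infinite_set A, (forall a, A a -> (0 < a)%N),
    pairwise_coprime A & forall a, A a -> P a].
Proof.
move=> /choice[c cP].
(* [L n] bounds the members chosen before step [n]. *)
pose L := fix L n := if n is n'.+1 then (L n' + c (L n'))%N else 0%N.
pose w n := c (L n).
have w1 n : (1 < w n)%N by have [] := cP (L n).
have Pw n : P (w n) by have [] := cP (L n).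
have wL i n : (i < n)%N -> (w i <= L n)%N.
  elim: n => // n IH; rewrite ltnS leq_eqVlt => /orP[/eqP ->|/IH]/=.
    exact: leq_addl.
  by move/leq_trans; apply; exact: leq_addr.
have cop i n : (i < n)%N -> coprime (w n) (w i).
  by move=> /wL h; have [_ _] := cP (L n); apply.
have winj : injective w.
  have aux i n : (i < n)%N -> w i <> w n.
    move=> /cop + E; rewrite E /coprime gcdnn => /eqP e; by have := w1 n; rewrite e.
  move=> i n E; apply/eqP; rewrite eqn_leq leqNgt [(n <= i)%N]leqNgt.
  by apply/andP; split; apply/negP => /aux; apply.
exists (range w); split.
- move=> fin; apply: infinite_nat.
  have -> : [set: nat] = w @^-1` range w by apply/seteqP; split => // n _; exists n.
  by apply: finite_preimage fin => i n _ _; exact: winj.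
- by move=> _ [n _ <-]; exact: ltnW.
- move=> _ _ [i _ <-] [n _ <-] ne.
  have [|/cop|E] := ltngtP i n; first by move=> /cop; rewrite coprime_sym.
    by [].
  by rewrite E eqxx in ne.
- by move=> _ [n _ <-].
Qed.

Section dilated.
Variable B : set nat.
Hypothesis B_pos : forall b, B b -> (0 < b)%N.

Local Notation D := (dilated_coprime_set B).
Local Notation C := (B `|` dilated_coprime_set B).

(** In a pairwise coprime set each of the finitely many primes of [X] divides at
most one member. *)
Lemma dilated_coprimeP d X : D d -> (0 < X)%N ->
  exists a, coprime a X /\ B (d * a)%N.
Proof.
move=> [d0 [A [Ainf A0 Acop AB]]] X0; apply: contrapT => /forallNP none.
apply: Ainf; have : A `<=` \bigcup_(p in [set` primes X]) [set a | A a /\ (p %| a)%N].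
  move=> a Aa; have : ~~ coprime a X.
    by apply/negP => ca; apply: (none a); split => //; exact: AB.
  move=> /(common_prime X0)[p [pp pa pX]]; exists p => //=.
  by rewrite mem_primes pp X0.
move/sub_finite_set; apply; apply: bigcup_finite; first exact: finite_seq.
move=> p /=; rewrite mem_primes => /andP[pp _].
have [[a [Aa pa]]|/forallNP none'] := pselect (exists a, A a /\ (p %| a)%N); last first.
  by rewrite (_ : [set _ | _] = set0)//; apply/seteqP; split => a //=; exact: none'.
apply: (@sub_finite_set _ _ [set a]) (finite_set1 _) => a' /= [Aa' pa'].
apply: contrapT => /eqP ne.
have := Acop _ _ Aa' Aa ne; rewrite /coprime => /eqP g1.
have : (p %| gcdn a' a)%N by rewrite dvdn_gcd pa'.
by rewrite g1 dvdn1 => /eqP p1; rewrite p1 in pp.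
Qed.

Lemma dilated_union_pos d : C d -> (0 < d)%N.
Proof. by case=> [/B_pos//|[]]. Qed.

(** Applying the dilation construction to [C] instead of [B] gives nothing new: a
factor [w] with [d w] in [D] is replaced by [w a] with [d w a] in [B] and [a]
coprime to [X]. *)
Lemma dilated_closed d : (0 < d)%N ->
  (forall X, (0 < X)%N -> exists w, coprime w X /\ C (d * w)%N) -> C d.
Proof.
move=> d0 H; have HB X : (0 < X)%N -> exists w, coprime w X /\ B (d * w)%N.
  move=> X0; have [w [wX [Bw|Dw]]] := H X X0; first by exists w.
  have [a [aX Ba]] := dilated_coprimeP Dw X0.
  exists (w * a)%N; rewrite mulnA; split => //.
  by rewrite coprimeMl wX.
have [Bd|nBd] := pselect (B d); [by left|right; split => //].
have [L|A [Ainf A0 Acop AB]] := @coprime_extraction (fun w => (0 < w)%N /\ B (d * w)%N); last first.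
  by exists A; split => // a /AB[].
have [w [wX Bw]] := HB _ (fact_gt0 L).
have w0 : (0 < w)%N by move: (B_pos Bw); rewrite muln_gt0 => /andP[].
exists w; split => //.
  rewrite ltn_neqAle w0 andbT; apply/eqP => w1; apply: nBd.
  by rewrite -w1 muln1 in Bw.
move=> w' w'L [w'0 _]; apply: coprime_dvdr wX; apply: dvdn_fact.
by rewrite w'0.
Qed.

(** Let [g] be the gcd of [r] and [M]. The progression contains [g v] with [v]
coprime to any given [X]. If [e] in [C] divides [g v], then [e = d w] with [d]
dividing [g] and [w] dividing [v], hence coprime to [X]. There are finitely many
candidates for [d], so one of them works for all [X], and it belongs to [C] by
[dilated_closed]. *)
Lemma progression_covered (M : nat) (r : int) : (0 < M)%N ->
  (forall k : int, exists d, C d /\ (d%:Z %| r + M%:Z * k)%Z) ->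
  exists d, [/\ C d, (d %| M)%N & (d%:Z %| r)%Z].
Proof.
move=> M0 cover; pose g := gcdn (absz r) M.
have g0 : (0 < g)%N by rewrite gcdn_gt0 M0 orbT.
have gM : (g %| M)%N by exact: dvdn_gcdr.
have gr : (g%:Z %| r)%Z by rewrite dvdzE/= dvdn_gcdl.
pose m := (M %/ g)%N; pose u := (r %/ g%:Z)%Z.
have rE : r = g%:Z * u by rewrite mulrC divzK.
have ME : M = (g * m)%N by rewrite mulnC divnK.
have um : coprime (absz u) m.
  have : (gcdn (g * absz u) (g * m) = g)%N by rewrite -ME -[RHS]/(gcdn (absz r) M) rE abszM.
  by rewrite -muln_gcdr => /eqP; rewrite -{2}(muln1 g) eqn_pmul2l.
have m0 : (0 < m)%N by rewrite divn_gt0// dvdn_leq.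
have step X : (0 < X)%N -> exists d', [/\ (d' %| g)%N & exists w, coprime w X /\ C (d' * w)%N].
  move=> X0; have [k ck] := coprime_in_progression m0 X0 um.
  have [d [Cd]] := cover k; rewrite {1}rE ME PoszM -mulrA -mulrDr.
  rewrite dvdzE abszM/= => dgv.
  have d0 := dilated_union_pos Cd.
  exists (gcdn d g); split; first exact: dvdn_gcdr.
  exists (d %/ gcdn d g)%N; split; last by rewrite mulnC divnK ?dvdn_gcdl.
  apply: coprime_dvdl ck.
  have gg0 : (0 < gcdn d g)%N by rewrite gcdn_gt0 d0.
  rewrite -(@Gauss_dvdr _ (g %/ gcdn d g)).
    rewrite -(dvdn_pmul2l gg0) mulnA [(_ * (d %/ _))%N]mulnC divnK ?dvdn_gcdl//.
    by rewrite [(_ * (g %/ _))%N]mulnC divnK ?dvdn_gcdr.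
  rewrite /coprime -(eqn_pmul2l gg0) muln_gcdr muln1.
  by rewrite ![(gcdn d g * (_ %/ _))%N]mulnC !divnK ?dvdn_gcdl ?dvdn_gcdr.
(* If each divisor of [g] failed for some [X], all would fail for the product. *)
have [d' d'g d'P] : exists2 d', (d' %| g)%N & forall X, (0 < X)%N ->
    exists w, coprime w X /\ C (d' * w)%N.
  apply: contrapT => none.
  have bad d' : exists X, (0 < X)%N /\ ((d' %| g)%N -> forall w, coprime w X -> ~ C (d' * w)%N).
    apply: contrapT => /forallNP h; apply: none; exists d'.
      by apply: contrapT => /negP nd; apply: (h 1%N); split => // /(negP nd).
    move=> X X0; apply: contrapT => /forallNP h'; apply: (h X); split => // _ w wX Cw.
    by apply: (h' w).
  have [Xf XfP] := choice bad.
  pose X := (\prod_(0 <= d' < g.+1) Xf d')%N.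
  have X0 : (0 < X)%N by apply: prodn_gt0 => i; have [] := XfP i.
  have [d' [d'g [w [wX Cw]]]] := step X X0.
  have [_ /(_ d'g w)] := XfP d'; apply => //.
  apply: coprime_dvdr wX; rewrite /X (big_rem d')/= ?dvdn_mulr//.
  by rewrite mem_index_iota ltnS (dvdn_leq g0).
exists d'; split.
- apply: (dilated_closed _ d'P); exact: dvdn_gt0 g0 d'g.
- exact: dvdn_trans gM.
- by apply: dvdz_trans gr; rewrite dvdzE.
Qed.

(** Removing the members of [C] that are divisible by another one does not change
the set of multiples: take the smallest divisor in [C]. *)
Lemma free_set_star n : free_set (star_set B) n <-> forall d, C d -> ~~ (d%:Z %| n)%Z.
Proof.
split=> [fn d Cd|H [d [Cd _] /= dn]]; last by have := H d Cd; rewrite dn.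
apply/negP => dn; apply: fn.
have ex : exists d, `[< C d >] && (d%:Z %| n)%Z by exists d; rewrite dn andbT; exact/asboolP.
case: (ex_minnP ex) => e /andP[/asboolP Ce en] emin; exists e => //; split => // a Ca ae.
apply/eqP; rewrite eqn_leq; apply/andP; split; first exact: dvdn_leq (dilated_union_pos Ce) ae.
apply: emin; apply/andP; split; first exact/asboolP.
by apply: dvdz_trans en; rewrite dvdzE.
Qed.

End dilated.

(** * Forcing zeros in a pattern of free positions *)

Lemma count_upto_shift (P : pred nat) (q S : nat) :
  (forall u, P (u + q)%N = P u) ->
  count_upto (fun u => P (u + S)%N) q = count_upto P q.
Proof.
elim: S P => [|S IH] P Pq.
  by apply: eq_bigr => u _; rewrite addn0.
under [LHS]eq_bigr do rewrite addnS -addSn.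
rewrite -[RHS](IH P Pq) {IH}.
case: q Pq => [|q] Pq; first by rewrite /count_upto !big_geq.
rewrite /count_upto big_nat_recr//= [RHS]big_ltn//= addnC.
rewrite [X in (_ + X)%N = _](_ : _ = \sum_(2 <= i < q.+2) P (i + S))%N; last first.
  by rewrite [RHS]big_add1.
by congr (_ + _)%N; rewrite (_ : (q.+2 + S = 1 + S + q.+1)%N) ?Pq//; lia.
Qed.

Lemma count_upto_blocks (P : pred nat) (e m : nat) :
  count_upto P (m * e) = (\sum_(1 <= u < e.+1) \sum_(0 <= t < m) P (u + t * e))%N.
Proof.
elim: m => [|m IH].
  by rewrite mul0n {1}/count_upto big_geq// big1// => u _; rewrite big_geq.
rewrite mulSn addnC count_upto_add IH -big_split/=.
by apply: eq_bigr => u _; rewrite big_nat_recr//= [(m * e + u)%N]addnC.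
Qed.

Section patterns.
Variables (R : realType) (B : set nat).
Hypothesis B_pos : forall b, B b -> (0 < b)%N.
Local Notation D := (dilated_coprime_set B).

Definition truncated_pattern (K M : nat) (r : int) (I : seq int) (n : nat) : bool :=
  (M%:Z %| n%:Z - r)%Z &&
  `[< forall b j, B b -> (b <= K)%N -> j \in I -> ~~ (b%:Z %| n%:Z + j)%Z >].

(** The lower bound on the density is the same for all [K]. For a pattern with this
property the truncation can be removed ([uniformly_dense_realized]). *)
Definition uniformly_dense (M : nat) (r : int) (I : seq int) : Prop :=
  exists2 delta : R, 0 < delta & forall K q, (0 < q)%N -> (M %| q)%N ->
    (forall b, B b -> (b <= K)%N -> (b %| q)%N) ->
    delta * q%:R <= (count_upto (truncated_pattern K M r I) q)%:R.

Lemma dvdz_addq (d q u : nat) (c : int) : (d %| q)%N ->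
  (d%:Z %| (u + q)%:Z + c)%Z = (d%:Z %| u%:Z + c)%Z.
Proof.
by move=> dq; rewrite PoszD addrAC rpredDr // dvdzE.
Qed.

Lemma truncated_pattern_periodic K M r I q : (M %| q)%N ->
  (forall b, B b -> (b <= K)%N -> (b %| q)%N) ->
  forall u, truncated_pattern K M r I (u + q) = truncated_pattern K M r I u.
Proof.
move=> Mq qK u; rewrite /truncated_pattern dvdz_addq//; congr (_ && _).
apply: asbool_equiv_eq; split=> H b j Bb bK jI.
  by rewrite -(dvdz_addq _ _ (qK _ Bb bK)); apply: H.
by rewrite (dvdz_addq _ _ (qK _ Bb bK)); apply: H.
Qed.

(** Shifting by a bound on the members of [I] makes all positions nonnegative,
and then [davenport_erdos_pattern] applies. *)
Lemma uniformly_dense_realized M r I : (0 < M)%N -> uniformly_dense M r I ->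
  exists k : int, (M%:Z %| k - r)%Z /\ forall j, j \in I -> free_set B (k + j).
Proof.
move=> M0 [delta delta0 dens].
pose S := (\sum_(j <- I) absz j)%N.
have SI j : j \in I -> 0 <= S%:Z + j.
  move=> jI; rewrite /S (big_rem j)//= PoszD.
  have : - (absz j)%:Z <= j by rewrite lerNl abszE -normrN ler_norm.
  by lia.
pose P (n : nat) := (M%:Z %| (n + S)%:Z - r)%Z.
pose T := [seq absz (S%:Z + j) | j <- I].
have TE n j : j \in I -> (n + absz (S%:Z + j)%R)%N%:Z = (n + S)%N%:Z + j.
  by move=> /SI jI; rewrite PoszD gez0_abs// PoszD addrA.
have [|K q q0 Mq qK|n [Pn free]] := davenport_erdos_pattern B_pos M0 (P := P) (T := T) _ delta0.
- by move=> u; rewrite /P addnAC dvdz_addq.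
- apply: le_trans (dens K q q0 Mq qK) _; rewrite ler_nat.
  rewrite -(count_upto_shift S (truncated_pattern_periodic r I Mq qK)).
  apply: le_count_upto => n /andP[Mn /asboolP H]; apply/andP; split => //.
  apply/allP => t /mapP[j jI ->]; apply/negP => /asboolP[b [Bb bK bn]].
  have := H b j Bb bK jI; rewrite -TE// => /negP; apply; by rewrite dvdzE.
- exists (n + S)%N%:Z; split => // j jI [b Bb /= bj].
  have := free (absz (S%:Z + j)) b (map_f _ jI) Bb.
  by rewrite -[(_ %| _)%N]/(b%:Z %| Posz _)%Z TE// bj.
Qed.

(** The new congruence is [n = - i] modulo [a]. A member [b] of [B] that shares a
prime [p] with [a] cannot divide [n + j] for [j] in [I]: otherwise [p] would
divide [i - j], which is nonzero and at most [S] in absolute value, whereas [a]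
is coprime to [S!]. The conditions for the members of [B] coprime to [a] have a
period [e] coprime to [a], so they are independent of the congruence, which
costs exactly a factor [a]. *)
Lemma uniformly_dense_kill M r I (i : int) (d a S : nat) :
  (0 < M)%N -> (0 < a)%N ->
  coprime a M -> coprime a S`! ->
  (forall j, j \in I -> i != j /\ (absz (i - j) <= S)%N) ->
  (d %| M)%N -> (d%:Z %| r + i)%Z -> uniformly_dense M r I ->
  exists r' : int, [/\ (M%:Z %| r' - r)%Z, ((d * a)%:Z %| r' + i)%Z &
    uniformly_dense (M * a) r' I].
Proof.
move=> M0 a0 aM aS iI dM dr [delta delta0 dens].
have Ma : coprimez M%:Z a%:Z by rewrite coprimezE coprime_sym.
pose r' := zchinese M%:Z a%:Z r (- i).
have r'M : (M%:Z %| r' - r)%Z.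
  by rewrite -eqz_mod_dvd; apply/eqP; exact: zchinese_modl.
have r'a : (a%:Z %| r' + i)%Z.
  by rewrite -[i]opprK -eqz_mod_dvd; apply/eqP; exact: zchinese_modr.
have ad : coprime d a by rewrite coprime_sym; exact: coprime_dvdr dM aM.
exists r'; split => //.
  rewrite PoszM Gauss_dvdz// r'a andbT.
  have -> : r' + i = (r' - r) + (r + i) by rewrite addrA subrK.
  by rewrite rpredD//; apply: dvdz_trans r'M; rewrite dvdzE.
exists (delta / a%:R) => [|K q q0 Maq qK]; first by rewrite divr_gt0// ltr0n.
(* The part of [K!] coprime to [a] is a multiple of each [b <= K] coprime to [a]. *)
pose e := (M * K`!`_(\pi(a)^'))%N.
have e0 : (0 < e)%N by rewrite muln_gt0 M0 part_gt0.
have ea : coprime e a.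
  rewrite coprimeMl coprime_sym aM/= coprime_sym.
  by apply: (@pnat_coprime \pi(a)); [exact: pnat_pi|exact: part_pnat].
have be b : B b -> (b <= K)%N -> coprime b a -> (b %| e)%N.
  move=> Bb bK ba; apply: dvdn_mull.
  rewrite -(@Gauss_dvdr _ (K`!`_\pi(a))) ?partnC ?fact_gt0//; first exact: dvd_fact Bb bK.
  rewrite coprime_sym; apply: (@pnat_coprime \pi(a)); first exact: part_pnat.
  by rewrite -coprime_pi' ?(B_pos Bb)// coprime_sym.
have Mq : (M %| q)%N by apply: dvdn_trans Maq; exact: dvdn_mulr.
have aq : (a %| q)%N by apply: dvdn_trans Maq; exact: dvdn_mull.
pose A n := (M%:Z %| n%:Z - r)%Z &&
  `[< forall b j, B b -> (b <= K)%N -> coprime b a -> j \in I -> ~~ (b%:Z %| n%:Z + j)%Z >].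
have Aper s : (M %| s)%N -> (forall b, B b -> (b <= K)%N -> coprime b a -> (b %| s)%N) ->
    forall u, A (u + s)%N = A u.
  move=> Ms sK u; rewrite /A dvdz_addq//; congr (_ && _).
  apply: asbool_equiv_eq; split=> H b j Bb bK ba jI.
    by rewrite -(dvdz_addq _ _ (sK _ Bb bK ba)); apply: H.
  by rewrite (dvdz_addq _ _ (sK _ Bb bK ba)); apply: H.
have Ae := Aper e (dvdn_mulr _ (dvdnn _)) be.
have Aq := Aper q Mq (fun b Bb bK _ => qK b Bb bK).
pose Z n := A n && (a%:Z %| n%:Z + i)%Z.
have Zq u : Z (u + q)%N = Z u by rewrite /Z Aq dvdz_addq.
have Zea u : Z (u + a * e)%N = Z u.
  by rewrite /Z (periodic_mul a Ae) dvdz_addq// dvdn_mulr.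
have Zpat n : Z n -> truncated_pattern K (M * a) r' I n.
  move=> /andP[/andP[nr /asboolP H] ni]; apply/andP; split.
    rewrite PoszM Gauss_dvdz//; apply/andP; split.
      have -> : n%:Z - r' = (n%:Z - r) - (r' - r) by rewrite opprB addrA subrK.
      by rewrite rpredB.
    have -> : n%:Z - r' = (n%:Z + i) - (r' + i) by ring.
    by rewrite rpredB.
  apply/asboolP => b j Bb bK jI; have [ba|ba] := boolP (coprime b a); first exact: H.
  have [p [pp pb pa]] := common_prime a0 ba.
  apply/negP => bn; have [ij ijS] := iI j jI.
  have pij : (p %| absz (i - j))%N.
    rewrite -[(_ %| _)%N]/(p%:Z %| _)%Z.
    have -> : i - j = (n%:Z + i) - (n%:Z + j) by ring.
    rewrite rpredB//; [apply: dvdz_trans ni|apply: dvdz_trans bn]; by rewrite dvdzE.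
  have pS : (p %| S`!)%N.
    apply: dvdn_fact; rewrite prime_gt0// (leq_trans _ ijS)// dvdn_leq//.
    by rewrite absz_gt0 subr_eq0.
  have : (p %| gcdn a S`!)%N by rewrite dvdn_gcd pa.
  by move: aS => /eqP ->; rewrite dvdn1 => /eqP p1; rewrite p1 in pp.
(* Each class modulo [e] meets the class of [- i] modulo [a]. *)
have ZA : (count_upto A e <= count_upto Z (a * e))%N.
  rewrite count_upto_blocks; apply: leq_sum => u _.
  case: (boolP (A u)) => // Au.
  have eza : coprimez e%:Z a%:Z by rewrite coprimezE.
  pose v := zchinese e%:Z a%:Z u%:Z (- i).
  have /dvdzP[k kE] : (e%:Z %| v - u%:Z)%Z.
    by rewrite -eqz_mod_dvd; apply/eqP; exact: zchinese_modl.
  have va : (a%:Z %| v + i)%Z.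
    by rewrite -[i]opprK -eqz_mod_dvd; apply/eqP; exact: zchinese_modr.
  pose t := absz (k %% a%:Z)%Z.
  have a0z : a%:Z != 0 by rewrite eqz_nat -lt0n.
  have tE : t%:Z = (k %% a%:Z)%Z by rewrite gez0_abs// modz_ge0.
  have ta : (t < a)%N by rewrite -ltz_nat tE ltz_mod.
  rewrite (bigD1_seq t) ?iota_uniq ?mem_index_iota//=.
  suff -> : Z (u + t * e)%N by [].
  rewrite /Z (periodic_mul t Ae) Au/= PoszD PoszM tE.
  rewrite (_ : _ + i = v + i - (k %/ a%:Z)%Z * e%:Z * a%:Z); last first.
    have -> : v = v - u%:Z + u%:Z by rewrite subrK.
    rewrite kE; have := divz_eq k a%:Z.
    by move: (k %/ a%:Z)%Z (k %% a%:Z)%Z => x y ->; ring.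
  by rewrite rpredB// dvdz_mull.
have cA : delta * q%:R <= (count_upto A q)%:R.
  apply: le_trans (dens K q q0 Mq qK) _; rewrite ler_nat; apply: le_count_upto => n.
  move=> /andP[nr /asboolP H]; apply/andP; split => //.
  by apply/asboolP => b j Bb bK _; exact: H.
have qR : (0 : R) < q%:R by rewrite ltr0n.
have eR : (0 : R) < e%:R by rewrite ltr0n.
have aR : (0 : R) < a%:R by rewrite ltr0n.
have aeR : (0 : R) < (a * e)%:R by rewrite natrM mulr_gt0.
apply: le_trans (_ : (count_upto Z q)%:R <= _); last first.
  by rewrite ler_nat; exact: le_count_upto.
have ae0 : (0 < a * e)%N by rewrite -(ltr0n R).
rewrite -ler_pdivlMr// (@count_upto_ratio R Z q (a * e))//.
apply: le_trans (_ : (count_upto A e)%:R / (a * e)%:R <= _); last first.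
  by rewrite ler_wpM2r ?invr_ge0// ler_nat.
rewrite natrM invfM mulrA [leRHS]mulrAC ler_wpM2r ?invr_ge0//.
by rewrite (@count_upto_ratio R A e q)// ler_pdivlMr.
Qed.

Lemma uniformly_dense_kill_all (s I : seq int) M r : (0 < M)%N ->
  (forall i, i \in s -> i \notin I /\
     exists d, [/\ D d, (d %| M)%N & (d%:Z %| r + i)%Z]) ->
  uniformly_dense M r I ->
  exists M' r', [/\ (0 < M')%N, (M %| M')%N, (M%:Z %| r' - r)%Z,
    uniformly_dense M' r' I &
    forall i, i \in s -> exists b, [/\ B b, (b %| M')%N & (b%:Z %| r' + i)%Z]].
Proof.
elim: s M r => [|i s IH] M r M0 sD gd.
  by exists M, r; split => //; rewrite subrr dvdz0.
have [iI [d [Dd dM dr]]] := sD i (mem_head _ _).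
pose S := (\sum_(j <- I) absz (i - j))%N.
have [a [aX Ba]] := dilated_coprimeP Dd (X := M * S`!) (ltac:(by rewrite muln_gt0 M0 fact_gt0)).
have a0 : (0 < a)%N by move: (B_pos Ba); rewrite muln_gt0 => /andP[].
move: aX; rewrite coprimeMr => /andP[aM aS].
have [|r1 [r1M r1a gd1]] := uniformly_dense_kill M0 a0 aM aS _ dM dr gd.
  move=> j jI; split; first by apply: contraNneq iI => ->.
  by rewrite /S (big_rem j)//= leq_addr.
have [||M' [r' [M'0 MM' Mr' gd' killed]]] := IH (M * a)%N r1 _ _ gd1.
- by rewrite muln_gt0 M0.
- move=> k ks; have [kI [c [Dc cM cr]]] := sD k (ltac:(by rewrite inE ks orbT)).
  split => //; exists c; split => //; first exact: dvdn_mulr.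
  have -> : r1 + k = (r1 - r) + (r + k) by rewrite addrA subrK.
  by rewrite rpredD//; apply: dvdz_trans r1M; rewrite dvdzE.
have M_Ma : (M %| M * a)%N by exact: dvdn_mulr.
exists M', r'; split => //.
- exact: dvdn_trans MM'.
- have -> : r' - r = (r' - r1) + (r1 - r) by rewrite addrA subrK.
  by rewrite rpredD//; apply: dvdz_trans Mr'; rewrite dvdzE.
- move=> k; rewrite inE => /orP[/eqP ->|/killed//].
  exists (d * a)%N; have daM : (d * a %| M * a)%N by exact: dvdn_mul.
  split => //; first exact: dvdn_trans MM'.
  have -> : r' + i = (r' - r1) + (r1 + i) by rewrite addrA subrK.
  by rewrite rpredD//; apply: dvdz_trans Mr'; rewrite dvdzE.
Qed.

Lemma pattern_realized (s I : seq int) M r : (0 < M)%N ->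
  (forall i, i \in s -> i \notin I /\
     exists d, [/\ D d, (d %| M)%N & (d%:Z %| r + i)%Z]) ->
  uniformly_dense M r I ->
  exists k : int, [/\ (M%:Z %| k - r)%Z, forall j, j \in I -> free_set B (k + j) &
    forall i, i \in s -> ~ free_set B (k + i)].
Proof.
move=> M0 sD /(uniformly_dense_kill_all M0 sD)[M' [r' [M'0 MM' Mr' gd' killed]]].
have [k [kr kI]] := uniformly_dense_realized M'0 gd'.
exists k; split => //.
- have -> : k - r = (k - r') + (r' - r) by rewrite addrA subrK.
  by rewrite rpredD//; apply: dvdz_trans kr; rewrite dvdzE.
- move=> i /killed[b [Bb bM br]]; apply; exists b => //=.
  have -> : k + i = (k - r') + (r' + i) by rewrite addrA subrK.
  by rewrite rpredD//; apply: dvdz_trans kr; rewrite dvdzE.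
Qed.

End patterns.

(** * The group H and its cells *)

Lemma residue1_mulrz_eq0 (b : nat) (n : int) : (0 < b)%N ->
  (residue1 b *~ n == 0) = (b%:Z %| n)%Z.
Proof.
move=> b0.
have nat_case k : (residue1 b *+ k == 0) = (b %| k)%N.
  rewrite /residue1; set x : residue b := inZp 1 *+ k.
  have -> : x = inZp k :> 'I_b.-1.+1.
    rewrite /x; elim: k {x} => [|k IH].
      by rewrite mulr0n; apply: val_inj; rewrite /= mod0n.
    rewrite mulrS IH; apply: val_inj => /=.
    by rewrite modnDm add1n.
  rewrite -(inj_eq val_inj)/= /dvdn.
  by case: b b0 {x}.
case: n => k; first by rewrite nat_case dvdzE.
by rewrite NegzE mulrNz oppr_eq0 nat_case rpredN dvdzE.
Qed.

Section groupH.
Variable B : set nat.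
Hypothesis B_pos : forall b, B b -> (0 < b)%N.

Lemma index_in_B (b : B) : B (\val b).
Proof. exact: set_mem (valP b). Qed.

(** The coordinates of [H] with index at most [L] form a cyclic group of this
order. *)
Definition level_modulus (L : nat) : nat :=
  \big[lcmn/1%N]_(b < L.+1 | `[< B b >]) b.

Local Notation lev := level_modulus.

Lemma dvdn_level_modulus L b : B b -> (b <= L)%N -> (b %| lev L)%N.
Proof.
move=> Bb bL; rewrite -ltnS in bL.
by rewrite /lev (biglcmn_sup (Ordinal bL))//; apply/asboolP.
Qed.

Lemma level_modulus_dvdz L (n : int) :
  (forall b, B b -> (b <= L)%N -> (b%:Z %| n)%Z) -> ((lev L)%:Z %| n)%Z.
Proof.
move=> H; rewrite dvdzE/=; apply/dvdn_biglcmP => b /asboolP Bb.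
by have := H b Bb; rewrite dvdzE/=; apply; rewrite -ltnS.
Qed.

Lemma level_modulus_gt0 L : (0 < lev L)%N.
Proof.
rewrite /lev; apply: (big_ind (fun n => (0 < n)%N)) => //.
  by move=> m n m0 n0; rewrite lcmn_gt0 m0.
by move=> i /asboolP/B_pos.
Qed.

Lemma level_modulus_dvd L L' : (L <= L')%N -> (lev L %| lev L')%N.
Proof.
move=> LL'; rewrite -[(_ %| _)%N]/((lev L)%:Z %| (lev L')%:Z)%Z.
apply: level_modulus_dvdz => b Bb bL; rewrite dvdzE/=.
by apply: dvdn_level_modulus => //; exact: leq_trans LL'.
Qed.

Local Notation G := (Ggrp B).
Local Notation H := (Hgrp B).

Definition cell (L : nat) (h : H) : set H :=
  [set g | forall b : B, (\val b <= L)%N -> \val g b = \val h b].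

Lemma cell_refl L h : cell L h h. Proof. by []. Qed.

Lemma cell_sym L h g : cell L h g -> cell L g h.
Proof. by move=> hg b bL; rewrite hg. Qed.

Lemma cell_trans L h g k : cell L h g -> cell L g k -> cell L h k.
Proof. by move=> hg gk b bL; rewrite gk// hg. Qed.

Lemma cell_sub L L' h : (L <= L')%N -> cell L' h `<=` cell L h.
Proof. by move=> LL' g hg b bL; apply: hg; exact: leq_trans LL'. Qed.

Lemma val_H_continuous : continuous (\val : H -> G).
Proof. exact: initial_continuous. Qed.

Lemma nbhs_coord (h : H) (b : B) : nbhs h [set g : H | \val g b = \val h b].
Proof.
have coord (z : G) : nbhs z [set w : G | w b = z b].
  have := @proj_continuous _ (fun b : B => residue (\val b)) b z [set z b].
  by apply; exact: (@discrete_set1 (residue (\val b))).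
exact: (val_H_continuous (coord (\val h))).
Qed.

Lemma nbhs_cell L (h : H) : nbhs h (cell L h).
Proof.
elim: L => [|L IH].
  apply: (@filterS _ _ _ setT); last exact: filterT.
  by move=> g _ b; rewrite leqNgt (B_pos (index_in_B b)).
have [BL|BL] := pselect (B L.+1); last first.
  apply: filterS IH => g hg b; rewrite leq_eqVlt => /orP[/eqP bL|]; last exact: hg.
  by case: BL; rewrite -bL; exact: index_in_B.
pose b0 : B := exist _ L.+1 (mem_set BL).
apply: filterS (filterI IH (nbhs_coord h b0)) => g [hg h0] b.
rewrite leq_eqVlt => /orP[/eqP bL|]; last exact: hg.
by have -> : b = b0 by exact: val_inj.
Qed.

Lemma cell_open L (h : H) : open (cell L h).
Proof.
rewrite openE => g hg; rewrite /interior.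
apply: filterS (nbhs_cell L g) => k gk; exact: cell_trans gk.
Qed.

Lemma nbhs_cellP (h : H) (O : set H) : nbhs h O -> exists L, cell L h `<=` O.
Proof.
move=> [_ [[W oW <-] Wh WO]].
pose F : set_system G := filter_from setT
  (fun L => [set g : G | forall b : B, (\val b <= L)%N -> g b = \val h b]).
have FF : Filter F.
  apply: filter_from_filter; first by exists 0%N.
  move=> i j _ _; exists (maxn i j) => // g gh; split=> b bi; apply: gh.
    by rewrite (leq_trans bi)// leq_maxl.
  by rewrite (leq_trans bi)// leq_maxr.
have Fh : F --> \val h.
  apply/cvg_sup => b U [V [[V'] oV <-] Vh VU].
  exists (\val b) => // g gh; apply: VU => /=.
  by rewrite /= gh.
have [L _ LW] : F W by apply: Fh; rewrite nbhsE; exists W.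
by exists L => g hg; apply: WO => /=; exact: LW.
Qed.

Lemma Delta_cellP L m n : cell L (DeltaH B m) (DeltaH B n) <->
  ((lev L)%:Z %| n - m)%Z.
Proof.
split=> [mn|lmn b bL].
  apply: level_modulus_dvdz => b Bb bL.
  have := mn (exist _ b (mem_set Bb)) bL.
  rewrite /= /Delta_G/= => /eqP; rewrite -subr_eq0 -mulrzBr.
  by rewrite residue1_mulrz_eq0// B_pos.
rewrite /= /Delta_G; apply/eqP; rewrite -subr_eq0 -mulrzBr.
rewrite residue1_mulrz_eq0 ?B_pos//; last exact: index_in_B.
apply: dvdz_trans lmn; rewrite dvdzE/=; apply: dvdn_level_modulus => //.
exact: index_in_B.
Qed.

Lemma cell_Delta L (h : H) : exists n, cell L h (DeltaH B n).
Proof.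
have Hh : H_set (\val h) by exact: set_mem (valP h).
have := nbhs_cell L h; rewrite /= => -[_ [[W oW <-] Wh WO]].
have [_ [[n _ <-] Wn]] : (range (@Delta_G B) `&` W !=set0).
  by apply: Hh; rewrite nbhsE; exists W.
by exists n; exact: (WO (DeltaH B n)).
Qed.

Lemma DeltaHD m n : DeltaH B (m + n) = DeltaH B m + DeltaH B n.
Proof.
apply: val_inj; apply: functional_extensionality_dep => b.
by rewrite /= /Delta_G mulrzDr.
Qed.

Lemma val_HD (g h : H) (b : B) : \val (g + h) b = \val g b + \val h b.
Proof. by []. Qed.

Lemma cellD L (h g k : H) : cell L h g -> cell L (h + k) (g + k).
Proof. by move=> hg b bL; rewrite !val_HD hg. Qed.

Lemma Delta_coord_eq0 (n : int) (b : B) :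
  (\val (DeltaH B n) b == 0) = ((\val b)%:Z %| n)%Z.
Proof. by rewrite /= /Delta_G residue1_mulrz_eq0 ?B_pos//; exact: index_in_B. Qed.

Lemma window_Delta n : window B (DeltaH B n) <-> free_set B n.
Proof.
split=> [wn [b Bb /= bn]|fn b].
  have := wn (exist _ b (mem_set Bb)); rewrite Delta_coord_eq0/=.
  by rewrite bn.
apply/negP; rewrite Delta_coord_eq0 => bn; apply: fn.
by exists (\val b) => //; exact: index_in_B.
Qed.

(** All integers that represent [h] up to level [L] have the divisibility
properties of [h] by the members of [B] up to [L]. *)
Lemma cell_coord_eq0 L (h : H) n (b : B) : (\val b <= L)%N ->
  cell L h (DeltaH B n) -> (\val h b == 0) = ((\val b)%:Z %| n)%Z.
Proof. by move=> bL hn; rewrite -(hn b bL) Delta_coord_eq0. Qed.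

Lemma compact_H : compact [set: H].
Proof.
have cG : compact [set: G].
  have := @tychonoff _ (fun b : B => residue (\val b)) (fun=> setT).
  have cres (b : B) : compact [set: residue (\val b)].
    exact: (@finite_compact (residue (\val b)) _ (@finite_finset 'I_(\val b).-1.+1 _)).
  move=> /(_ cres); congr compact; exact/seteqP.
have cHs : compact (@H_set B).
  by apply: subclosed_compact cG _ => //; exact: closed_closure.
rewrite compact_ultra => F FU _.
have FP : ProperFilter F := @ultra_proper _ _ FU.
pose F' : set_system G := (\val : H -> G) @ F.
have F'H : F' (@H_set B).
  by apply: (@filterS _ F _ setT); [move=> h _; exact: set_mem (valP h)|exact: filterT].
have [g [Hg clg]] := cHs F' _ F'H.
exists (exist _ g (mem_set Hg)); split => // U [_ [[W oW <-] Wh WU]].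
apply: filterS WU _.
have [//|FnW] := in_ultra_setVsetC ((\val : H -> G) @^-1` W) FU.
have [x [nWx Wx]] := clg (~` W) W FnW (open_nbhs_nbhs (conj oW Wh)).
by case: (nWx Wx).
Qed.

End groupH.

(** * The window and its regularisation *)

Section window.
Variable B : set nat.
Hypothesis B_pos : forall b, B b -> (0 < b)%N.

Local Notation D := (dilated_coprime_set B).
Local Notation C := (B `|` dilated_coprime_set B).
Local Notation lev := (level_modulus B).
Local Notation Delta := (DeltaH B).
Local Notation W := (window B).
Local Notation H := (Hgrp B).

Lemma not_windowP (h : H) : ~ W h <-> exists b : B, \val h b == 0.
Proof.
split=> [/existsNP[b /negP]|[b hb] Wh]; first by rewrite negbK; exists b.
by have := Wh b; rewrite hb.
Qed.

Lemma window_closed : closed W.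
Proof.
rewrite -openC openE => h /= /not_windowP[b hb]; rewrite /interior.
apply: filterS (nbhs_coord h b) => g gh; apply/not_windowP; exists b.
by rewrite (gh : \val g b = _).
Qed.

Lemma window_reg_sub : window_reg B `<=` W.
Proof.
have := closure_subset (@interior_subset _ W).
by rewrite -[X in _ `<=` X](closure_id W).1//; exact: window_closed.
Qed.

Lemma window_interiorP (h : H) : W° h <-> exists L, cell L h `<=` W.
Proof.
split=> [|[L hL]]; first exact: nbhs_cellP.
rewrite /interior; apply: filterS hL _; exact: nbhs_cell.
Qed.

Lemma window_interior_reg : W° `<=` window_reg B.
Proof. exact: subset_closure. Qed.

Lemma not_window_regP (h : H) : ~ window_reg B h ->
  exists L, forall g, cell L h g -> ~ W° g.
Proof.
move=> nh; have /nbhs_cellP[L hL] : nbhs h (~` window_reg B).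
  by apply: open_nbhs_nbhs; split => //; rewrite openC; exact: closed_closure.
by exists L => g /hL ng /window_interior_reg.
Qed.

(** For each [L] some [b] in [B] has [gcd (b, level_modulus L)] dividing [n]:
otherwise the cell of [n] at level [L] is inside the window. If [n] is nonzero,
these gcds take finitely many values, and one value [e] recurs at arbitrarily
large levels. If [e] is not in [B], the corresponding quotients [b / e] exceed
[1] and can be chosen pairwise coprime, since the earlier [b] divide the later
level moduli. So [e] belongs to [D]. *)
Lemma Delta_in_multiples (n : int) : ~ W° (Delta n) ->
  exists d, C d /\ (d%:Z %| n)%Z.
Proof.
move=> nW.
have step L : exists b, B b /\ ((gcdn b (lev L))%:Z %| n)%Z.
  apply: contrapT => none; apply: nW; apply/window_interiorP; exists L => g gn.
  apply: contrapT => /not_windowP[b gb]; apply: none; exists (\val b).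
  split; first exact: index_in_B.
  have [m gm] := cell_Delta B_pos (maxn L (\val b)) g.
  have bm : ((\val b)%:Z %| m)%Z by rewrite -(cell_coord_eq0 B_pos (leq_maxr _ _) gm).
  have : cell L (Delta n) (Delta m).
    by apply: cell_trans gn _; apply: cell_sub gm; exact: leq_maxl.
  move=> /(Delta_cellP B_pos) Lmn.
  have -> : n = m - (m - n) by rewrite opprB addrC subrK.
  rewrite rpredB//; [apply: dvdz_trans bm|apply: dvdz_trans Lmn]; rewrite dvdzE/=.
    exact: dvdn_gcdl.
  exact: dvdn_gcdr.
have [nB|nB] := pselect (exists b, B b /\ (b%:Z %| n)%Z).
  by case: nB => b [Bb bn]; exists b; split => //; left.
have n0 : n != 0.
  apply/eqP => n0; apply: nB; have [b [Bb _]] := step 0%N.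
  by exists b; rewrite n0 dvdz0.
have [e eP] : exists e, forall L, exists L' b,
    [/\ (L <= L')%N, B b, gcdn b (lev L') = e & (e%:Z %| n)%Z].
  apply: contrapT => /forallNP bad.
  have {bad} /choice[f fP] e : exists L, forall L' b, (L <= L')%N -> B b ->
      gcdn b (lev L') = e -> ~~ (e%:Z %| n)%Z.
    have /existsNP[L hL] := bad e; exists L => L' b LL' Bb be.
    by apply/negP => en; apply: hL; exists L', b.
  pose L := (\sum_(0 <= e < (absz n).+1) f e)%N.
  have [b [Bb bn]] := step L.
  have bn' : (gcdn b (lev L) < (absz n).+1)%N.
    by rewrite ltnS dvdn_leq ?absz_gt0// -[(_ %| _)%N]/(_ %| n)%Z.
  have fL : (f (gcdn b (lev L)) <= L)%N.
    have mem : gcdn b (lev L) \in index_iota 0 (absz n).+1 by rewrite mem_index_iota.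
    by rewrite {2}/L (big_rem _ mem)/= leq_addr.
  by have := fP _ _ _ fL Bb erefl; rewrite bn.
have en : (e%:Z %| n)%Z by have [L' [b []]] := eP 0%N.
have e0 : (0 < e)%N.
  by have [L' [b [_ /B_pos b0 <- _]]] := eP 0%N; rewrite gcdn_gt0 b0.
exists e; split => //; right; split => //.
have [L|A [Ainf A0 Acop AB]] := @coprime_extraction (fun w => B (e * w)%N);
  last by exists A.
have [L' [b [LL' Bb be _]]] := eP (e * L)%N.
have eb : (e %| b)%N by rewrite -be dvdn_gcdl.
have bE : b = (e * (b %/ e))%N by rewrite mulnC divnK.
exists (b %/ e)%N; split; rewrite -?bE//.
  rewrite ltn_neqAle divn_gt0// (dvdn_leq (B_pos Bb) eb) andbT.
  apply/eqP => w1; apply: nB; exists b; split => //.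
  by rewrite bE -w1 muln1.
move=> w' w'L Bw'.
have : (gcdn b (e * w') %| e)%N.
  rewrite -[X in (_ %| X)%N]be dvdn_gcd dvdn_gcdl/=.
  apply: dvdn_trans (dvdn_gcdr _ _) _; apply: dvdn_level_modulus => //.
  by rewrite (leq_trans _ LL')// leq_mul2l w'L orbT.
by rewrite {1}bE -muln_gcdr -[X in (_ %| X)%N]muln1 dvdn_pmul2l// dvdn1.
Qed.

(** Near any point divisible by [d] there is an integer divisible by [d a], where
[d a] is in [B] and [a] is coprime to the level modulus. So the clopen set of the
points divisible by [d] does not meet the interior of the window, nor the
closure of this interior. *)
Lemma cell_avoids_window_reg d L (n : int) (g : H) : C d -> (d %| lev L)%N ->
  (d%:Z %| n)%Z -> cell L (Delta n) g -> ~ window_reg B g.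
Proof.
move=> Cd dL dn gn Wg.
have [k [Wk gk]] := Wg _ (nbhs_cell B_pos L g).
have {Wk} /window_interiorP[L1 kL1] := Wk.
pose L' := maxn L L1.
have [m km] := cell_Delta B_pos L' k.
have dm : (d%:Z %| m)%Z.
  have : cell L (Delta n) (Delta m).
    apply: cell_trans gn _; apply: cell_trans gk _.
    by apply: cell_sub km; exact: leq_maxl.
  move=> /(Delta_cellP B_pos) Lmn.
  have -> : m = (m - n) + n by rewrite subrK.
  by rewrite rpredD//; apply: dvdz_trans Lmn; rewrite dvdzE.
have inW m' : ((lev L')%:Z %| m' - m)%Z -> free_set B m'.
  move=> /(Delta_cellP B_pos) mm'; apply/(window_Delta B_pos); apply: kL1.
  by apply: cell_sub (cell_trans km mm'); exact: leq_maxr.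
case: Cd => [Bd|Dd].
  by apply: (inW m); [rewrite subrr dvdz0|exists d].
have [a [aL Ba]] := dilated_coprimeP Dd (level_modulus_gt0 B_pos L').
have cz : coprimez (lev L')%:Z a%:Z by rewrite coprimezE coprime_sym.
pose m' := zchinese (lev L')%:Z a%:Z m 0.
have m'm : ((lev L')%:Z %| m' - m)%Z.
  by rewrite -eqz_mod_dvd; apply/eqP; exact: zchinese_modl.
have am' : (a%:Z %| m')%Z.
  by rewrite -[m']subr0 -eqz_mod_dvd; apply/eqP; exact: zchinese_modr.
have dL' : (d %| lev L')%N.
  by apply: dvdn_trans dL _; apply: level_modulus_dvd; exact: leq_maxl.
apply: (inW m' m'm); exists (d * a)%N => //=.
rewrite PoszM Gauss_dvdz; last first.
  by rewrite coprimezE/= coprime_sym; exact: coprime_dvdr aL.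
rewrite am' andbT.
have -> : m' = (m' - m) + m by rewrite subrK.
by rewrite rpredD//; apply: dvdz_trans m'm; rewrite dvdzE.
Qed.

(** A whole cell of [h] avoids the interior of the window; by
[Delta_in_multiples] the integers of this cell, which form a progression, are
all multiples of members of [C], and [progression_covered] gives one common
divisor. *)
Lemma not_window_reg_divisor (h : H) : ~ window_reg B h ->
  exists d L, [/\ C d, (d %| lev L)%N &
    forall n, cell L h (Delta n) -> (d%:Z %| n)%Z].
Proof.
move=> /not_window_regP[L hL]; have [r hr] := cell_Delta B_pos L h.
have [k|d [Cd dL dr]] := progression_covered B_pos (level_modulus_gt0 B_pos L) (r := r).
  apply: Delta_in_multiples; apply: hL; apply: cell_trans hr _.
  by apply/(Delta_cellP B_pos); rewrite addrC addKr dvdz_mulr.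
exists d, L; split => // n hn.
have /(Delta_cellP B_pos) : cell L (Delta r) (Delta n).
  exact: cell_trans (cell_sym hr) hn.
move=> rn; have -> : n = (n - r) + r by rewrite subrK.
by rewrite rpredD//; apply: dvdz_trans rn; rewrite dvdzE.
Qed.

End window.

(** * Borel probabilities on spaces with a filtration by cells *)

(** Joint pointed and topological structures, activated only in the sections on
Borel sets of products. *)
Module PointedSpaces.
HB.instance Definition _ (I : Type) (T : I -> ptopologicalType) :=
  Pointed.on (prod_topology T).
HB.instance Definition _ (T U : ptopologicalType) := Pointed.on (T * U)%type.
End PointedSpaces.

(** Nested partitions into clopen cells that form a base of the topology. All
measure-theoretic arguments below are reduced to unions of cells of one level. *)
Record cell_system (T : topologicalType) (E : nat -> T -> set T) : Prop := CellSystem {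
  cs_refl : forall L x, E L x x ;
  cs_sym : forall L x y, E L x y -> E L y x ;
  cs_trans : forall L x y z, E L x y -> E L y z -> E L x z ;
  cs_mono : forall L L' x, (L <= L')%N -> E L' x `<=` E L x ;
  cs_nbhs : forall L x, nbhs x (E L x) ;
  cs_base : forall x O, nbhs x O -> exists L, E L x `<=` O }.

Definition saturated (T : Type) (E : nat -> T -> set T) (L : nat) (A : set T) :=
  forall x y, E L x y -> A x -> A y.

Section cells.
Context {T : topologicalType} (E : nat -> T -> set T).
Hypothesis cs : cell_system E.

Lemma saturated_open L A : saturated E L A -> open A.
Proof.
move=> sA; rewrite openE => x Ax; rewrite /interior.
by apply: filterS (cs_nbhs cs L x) => y xy; exact: sA Ax.
Qed.

Lemma saturatedC L A : saturated E L A -> saturated E L (~` A).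
Proof. by move=> sA x y xy nAx Ay; apply: nAx; apply: sA Ay; exact: cs_sym. Qed.

Lemma saturatedI L A A' : saturated E L A -> saturated E L A' -> saturated E L (A `&` A').
Proof. by move=> sA sA' x y xy [Ax Ax']; split; [exact: sA Ax|exact: sA' Ax']. Qed.

Lemma saturatedU L A A' : saturated E L A -> saturated E L A' -> saturated E L (A `|` A').
Proof. by move=> sA sA' x y xy [Ax|Ax]; [left; exact: sA Ax|right; exact: sA' Ax]. Qed.

Lemma saturated_mono L L' A : (L <= L')%N -> saturated E L A -> saturated E L' A.
Proof. by move=> LL' sA x y xy; apply: sA; exact: cs_mono LL' _ xy. Qed.

Definition inner_approx (O : set T) (L : nat) : set T := [set x | E L x `<=` O].

Lemma inner_approx_saturated O L : saturated E L (inner_approx O L).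
Proof. by move=> x y xy xO z yz; apply: xO; exact: cs_trans yz. Qed.

Lemma inner_approx_nd O : {homo inner_approx O : L L' / (L <= L')%N >-> (L <= L')%O}.
Proof.
move=> L L' LL'; rewrite subsetEset => x xO y xy; apply: xO.
exact: cs_mono LL' _ xy.
Qed.

(** An open set is an increasing union of saturated sets. So saturated sets
generate the Borel sets, and probabilities are continuous along this union. *)
Lemma inner_approx_bigcup O : open O -> O = \bigcup_L inner_approx O L.
Proof.
move=> oO; apply/seteqP; split => [x Ox|x [L _ xO]].
  have [L LO] := cs_base cs (open_nbhs_nbhs (conj oO Ox)).
  by exists L.
by apply: xO; exact: cs_refl.
Qed.

End cells.

Section uniqueness.
Context {T : ptopologicalType} (E : nat -> T -> set T) {R : realType}.
Hypothesis cs : cell_system E.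
Local Open Scope ereal_scope.

Lemma open_measurable (A : set (borel T)) : @open T A -> measurable A.
Proof. exact: sub_sigma_algebra. Qed.

Lemma closed_measurable (A : set (borel T)) : @closed T A -> measurable A.
Proof.
move=> cA; rewrite -[A]setCK; apply: measurableC; apply: open_measurable.
by rewrite openC.
Qed.

Lemma saturated_measurable L (A : set (borel T)) : saturated E L A -> measurable A.
Proof. by move=> sA; apply: open_measurable; exact: saturated_open sA. Qed.

Lemma probability_eq_saturated (mu nu : probability (borel T) R) :
  (forall L A, saturated E L A -> mu A = nu A) ->
  forall A : set (borel T), measurable A -> mu A = nu A.
Proof.
move=> eqE A mA.
have eqO (O : set (borel T)) : @open T O -> mu O = nu O.
  move=> oO; rewrite (inner_approx_bigcup cs oO).
  have mF L : measurable (inner_approx E O L : set (borel T)).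
    by apply: saturated_measurable; exact: inner_approx_saturated.
  have mU : measurable (\bigcup_L inner_approx E O L : set (borel T)).
    exact: bigcup_measurable.
  have nd := inner_approx_nd cs O.
  have c1 := nondecreasing_cvg_mu (mu := mu) mF mU nd.
  have c2 := nondecreasing_cvg_mu (mu := nu) mF mU nd.
  have e : mu \o inner_approx E O = nu \o inner_approx E O.
    apply/funext => L /=; rewrite -(eqE L)//; exact: inner_approx_saturated.
  by rewrite e in c1; exact: cvg_unique c1 c2.
apply: (@measure_unique _ R (borel T) (@open T) (fun=> setT)) => //.
- exact: openI.
- by move=> _; exact: openT.
- by rewrite bigcup_const.
- by move=> n; apply: (le_lt_trans (probability_le1 _ _)) => //; rewrite ltry.
Qed.

End uniqueness.

Section extension.
Context {T : ptopologicalType} {R : realType} (E : nat -> T -> set T).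
Hypothesis cs : cell_system E.
Hypothesis cptT : compact [set: T].
Variable m : set T -> R.
Hypothesis m_ge0 : forall A, 0 <= m A.
Hypothesis mT : m setT = 1.
Hypothesis m0 : m set0 = 0.
Hypothesis mU : forall A A', A `&` A' = set0 -> m (A `|` A') = m A + m A'.

(** A copy of [T] that carries the ring of the saturated sets of all levels. *)
Definition cell_ring of cell_system E : Type := T.
Local Notation cT := (cell_ring cs).
HB.instance Definition _ := Pointed.on cT.

Definition saturated_sets : set (set cT) := [set A | exists L, saturated E L A].

Let sat0 : saturated_sets set0. Proof. by exists 0%N. Qed.

Let satU : setU_closed saturated_sets.
Proof.
move=> A A' [L sA] [L' sA']; exists (maxn L L'); apply: saturatedU.
  exact: (saturated_mono cs (leq_maxl L L') sA).
exact: (saturated_mono cs (leq_maxr L L') sA').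
Qed.

Let satD : setD_closed saturated_sets.
Proof.
move=> A A' [L sA] [L' sA']; exists (maxn L L'); rewrite setDE; apply: saturatedI.
  exact: (saturated_mono cs (leq_maxl L L') sA).
exact: (saturatedC cs (saturated_mono cs (leq_maxr L L') sA')).
Qed.

HB.instance Definition _ := @isRingOfSets.Build (sigma_display (@open T)) cT
  saturated_sets sat0 satU satD.


Let mu (A : set cT) : \bar R := (m A)%:E.

Let mu0 : mu set0 = 0%E. Proof. by rewrite /mu m0. Qed.

Let mu_ge0 A : (0 <= mu A)%E. Proof. by rewrite lee_fin. Qed.

Let m_bigsetU (F : nat -> set T) n : trivIset setT F ->
  m (\big[setU/set0]_(i < n) F i) = \sum_(i < n) m (F i).
Proof.
move=> tF; elim: n => [|n IH]; first by rewrite !big_ord0.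
rewrite !big_ord_recr/= mU ?IH//.
by apply: (trivIset_bigsetUI (D := predT)) => //; exact: sub_trivIset tF.
Qed.

Let mu_sigma : semi_sigma_additive mu.
Proof.
move=> F mF tF [L sU].
have Uclosed : closed (\bigcup_n F n : set T).
  by rewrite -openC; apply: (saturated_open cs (saturatedC cs sU)).
have Ucpt : compact (\bigcup_n F n : set T).
  by apply: subclosed_compact cptT _.
have oF i : open (F i : set T) by have [L' sF] := mF i; exact: (saturated_open cs sF).
(* The union is compact and the [F n] are open and disjoint: only finitely many
   of them are nonempty, so that countable additivity is finite additivity. *)
have : cover_compact (\bigcup_n F n : set T) by rewrite -compact_cover.
move=> /(_ nat setT F (fun i _ => oF i)) [//|D _ cov].
pose N := (\max_(i <- finmap.enum_fset D) i).+1.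
have UN : \bigcup_n F n = \big[setU/set0]_(i < N) F i.
  rewrite -bigcup_mkord; apply/seteqP; split => x.
    move=> /cov[i /= iD Fx]; exists i => //=.
    by rewrite /N ltnS; apply: leq_bigmax_seq.
  by move=> [i _ Fx]; exists i.
apply: cvg_near_cst; exists N => // n /= Nn.
rewrite -(subnKC Nn) (@big_cat_nat _ _ _ N)//= ?leq_addr//.
rewrite [X in _ + X]big_nat_cond [X in _ + X]big1 ?adde0; last first.
  move=> i /andP[/andP[Ni _] _]; suff -> : F i = set0 by [].
  rewrite -subset0 => x Fx; have : (\bigcup_n F n) x by exists i.
  rewrite UN -bigcup_mkord => -[k /= kN Fkx].
  have ik := tF i k I I; have : i = k by apply: ik; exists x.
  by move=> ik'; move: kN; rewrite -ik' ltnNge Ni.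
by rewrite UN /mu m_bigsetU// big_mkord sumEFin.
Qed.

HB.instance Definition _ := isMeasure.Build _ cT R mu mu0 mu_ge0 mu_sigma.

Let sigmaE : <<s @measurable _ cT >> = <<s @open T >>.
Proof.
apply/seteqP; split; apply: smallest_sub => //; try exact: smallest_sigma_algebra.
  move=> A [L sA]; apply: sub_sigma_algebra; exact: (saturated_open cs sA).
move=> O oO; rewrite (inner_approx_bigcup cs oO).
have sa : sigma_algebra setT <<s @measurable _ cT >> by exact: smallest_sigma_algebra.
case: sa => _ _; apply => L; apply: sub_sigma_algebra; exists L.
exact: inner_approx_saturated.
Qed.

Definition extension (A : set (borel T)) : \bar R := measure_extension mu A.

Let ext0 : extension set0 = 0%E. Proof. exact: measure0. Qed.

Let ext_ge0 A : (0 <= extension A)%E. Proof. exact: measure_ge0. Qed.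

Let ext_sigma : semi_sigma_additive extension.
Proof.
move=> F mF tF mUF; apply: measure_semi_sigma_additive => //.
  by move=> i; rewrite /measurable/= sigmaE; exact: mF.
by rewrite /measurable/= sigmaE.
Qed.

HB.instance Definition _ := isMeasure.Build _ (borel T) R extension ext0 ext_ge0 ext_sigma.

Lemma extensionE L A : saturated E L A -> extension A = (m A)%:E.
Proof.
move=> sA; rewrite /extension /measure_extension measurable_mu_extE//.
by exists L.
Qed.

Let extT : extension setT = 1%E.
Proof. by rewrite (@extensionE 0%N)// mT. Qed.

HB.instance Definition _ := Measure_isProbability.Build _ _ _ extension extT.

Lemma content_extension : exists rho : probability (borel T) R,
  forall L A, saturated E L A -> rho A = (m A)%:E.
Proof. by exists extension => L A; exact: extensionE. Qed.

End extension.

Section ultralimit.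
Variable R : realType.

(** An ultrafilter finer than the neighbourhoods of infinity gives a limit to all
sequences with values in a compact interval. *)
Lemma bounded_ultralimit : exists lim : (nat -> R) -> R,
  forall u, (forall n, 0 <= u n <= 1) ->
    [/\ 0 <= lim u <= 1,
     forall l, u @ \oo --> l -> lim u = l,
     forall v, (forall n, 0 <= v n <= 1) -> (u \- v) @ \oo --> (0 : R) -> lim u = lim v &
     forall v w, (forall n, 0 <= v n <= 1) -> (forall n, 0 <= w n <= 1) ->
       u = v \+ w -> lim u = lim v + lim w].
Proof.
have [U [UU ooU]] := @ultraFilterLemma nat \oo _.
have UP : ProperFilter U := @ultra_proper _ _ UU.
have cv u : (forall n, 0 <= u n <= 1) -> exists l : R, 0 <= l <= 1 /\ u @ U --> l.
  move=> u01.
  have Uu : (u @ U) `[0, 1]%classic.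
    by apply: (@filterS _ U _ setT); [move=> n _ /=; rewrite in_itv/=; exact: u01|exact: filterT].
  have [l [l01 cl]] := @segment_compact R 0 1 (u @ U) _ Uu.
  exists l; split; first by move: l01; rewrite /= in_itv.
  move=> V Vl; have [//|UV] := in_ultra_setVsetC (u @^-1` V) UU.
  by have [x [nVx /nVx]] := cl (~` V) V UV Vl.
have /choice[lim limP] u : exists l : R, (forall n, 0 <= u n <= 1) ->
    0 <= l <= 1 /\ u @ U --> l.
  have [/cv[l hl]|nu] := pselect (forall n, 0 <= u n <= 1); first by exists l.
  by exists 0 => /nu.
exists lim => u u01; have [l01 ul] := limP u u01; split => //.
- move=> l /(cvg_trans _) ucv.
  apply: (@cvg_unique _ (@Rhausdorff R) (u @ U)) => //.
  by apply: ucv; exact: cvg_app.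
- move=> v v01 /(cvg_trans _) uv0; have [_ vl] := limP v v01.
  apply/eqP; rewrite -subr_eq0; apply/eqP.
  apply: (@cvg_unique _ (@Rhausdorff R) ((u \- v) @ U)) => //.
    exact: cvgB ul vl.
  by apply: uv0; exact: cvg_app.
- move=> v w v01 w01 uE.
  have [_ vl] := limP v v01; have [_ wl] := limP w w01.
  apply: (@cvg_unique _ (@Rhausdorff R) (u @ U)) => //.
  by rewrite uE; exact: cvgD vl wl.
Qed.

End ultralimit.

(** * Rotation-invariant probabilities on H *)

Lemma g_sigma_borel_preimage (T U : ptopologicalType) (f : T -> U) :
  (forall O, open O -> measurable (f @^-1` O : set (borel T))) ->
  forall A : set (borel U), measurable A -> measurable (f @^-1` A : set (borel T)).
Proof.
move=> fO; apply: smallest_sub => /=; last exact: fO.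
have [s0 sD sU] : sigma_algebra setT (@measurable _ (borel T)) by exact: smallest_sigma_algebra.
split => /=.
- by rewrite preimage_set0.
- by move=> A mA; rewrite setTD preimage_setC; apply: measurableC.
- by move=> F mF; rewrite preimage_bigcup; exact: bigcup_measurable.
Qed.

Lemma continuous_borel_preimage (T U : ptopologicalType) (f : T -> U) :
  continuous f -> forall A : set (borel U), measurable A ->
  measurable (f @^-1` A : set (borel T)).
Proof.
move=> cf; apply: g_sigma_borel_preimage => O oO; apply: open_measurable.
by apply: open_comp => // x _; exact: cf.
Qed.

Definition word_cell (N : nat) (x : biseq) : set biseq :=
  [set y : biseq | forall i : int, (absz i <= N)%N -> y i = x i].

Lemma nbhs_biseq_coord (i : int) (x : biseq) : nbhs x [set y : biseq | y i = x i].
Proof.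
have := @proj_continuous _ (fun _ : int => bool) i x [set x i]; apply.
exact: (@discrete_set1 bool).
Qed.

Lemma word_cell_system : cell_system word_cell.
Proof.
split.
- by [].
- by move=> N x y xy i iN; rewrite xy.
- by move=> N x y z xy yz i iN; rewrite yz// xy.
- by move=> N N' x NN' y xy i iN; apply: xy; exact: leq_trans NN'.
- move=> N x; elim: N => [|N IH].
    apply: filterS (nbhs_biseq_coord 0 x) => y y0 i; rewrite leqn0 absz_eq0 => /eqP ->.
    exact: y0.
  apply: filterS (filterI IH (filterI (nbhs_biseq_coord N.+1%:Z x)
    (nbhs_biseq_coord (- N.+1%:Z) x))) => y [yN [yp ym]] i; rewrite leq_eqVlt => /orP[/eqP iN|]; last exact: yN.
  by case: i iN => k /= kN; [rewrite kN|rewrite NegzE kN].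
- move=> x O xO.
  pose F : set_system biseq := filter_from setT (fun N => word_cell N x).
  have FF : Filter F.
    apply: filter_from_filter; first by exists 0%N.
    move=> i j _ _; exists (maxn i j) => // y xy; split=> k ki; apply: xy.
      by rewrite (leq_trans ki)// leq_maxl.
    by rewrite (leq_trans ki)// leq_maxr.
  have Fx : F --> x.
    apply/cvg_sup => i U [V [[V'] oV <-] Vh VU].
    exists (absz i) => // y xy; apply: VU => /=.
    by rewrite /= xy.
  by have [N _ NO] := Fx _ xO; exists N.
Qed.

Lemma compact_biseq : compact [set: biseq].
Proof.
have := @tychonoff _ (fun _ : int => bool) (fun=> setT).
have cb (i : int) : compact [set: bool] by exact: (@finite_compact bool _ (@finite_finset bool _)).
by move=> /(_ cb); congr compact; exact/seteqP.
Qed.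

Section prod.
Context {T U : topologicalType} (E : nat -> T -> set T) (E' : nat -> U -> set U).

Definition prod_cell (L : nat) (x : T * U) : set (T * U) := E L x.1 `*` E' L x.2.

Lemma prod_cell_system : cell_system E -> cell_system E' -> cell_system prod_cell.
Proof.
move=> cE cE'; split.
- by move=> L x; split; [exact: (cs_refl cE)|exact: (cs_refl cE')].
- by move=> L x y [h h']; split; [exact: (cs_sym cE)|exact: (cs_sym cE')].
- by move=> L x y z [h h'] [k k']; split; [exact: (cs_trans cE) k|exact: (cs_trans cE') k'].
- by move=> L L' x LL' y [h h']; split; [exact: (cs_mono cE LL')|exact: (cs_mono cE' LL')].
- move=> L [x x']; exists (E L x, E' L x') => //=; split; [exact: (cs_nbhs cE)|exact: (cs_nbhs cE')].
- move=> [x x'] O [[P Q] /= [xP xQ] PQO].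
  have [L LP] := cs_base cE xP; have [L' LQ] := cs_base cE' xQ.
  exists (maxn L L') => -[y y'] [/= h h']; apply: PQO; split => /=.
    by apply: LP; exact: (cs_mono cE (leq_maxl L L')).
  by apply: LQ; exact: (cs_mono cE' (leq_maxr L L')).
Qed.
End prod.

Section haar.
Variables (R : realType) (B : set nat).
Hypothesis B_pos : forall b, B b -> (0 < b)%N.
Local Notation H := (Hgrp B).
Local Notation lev := (level_modulus B).
Local Notation Delta := (DeltaH B).

Lemma Hgrp_cell_system : cell_system (@cell B).
Proof.
split.
- by [].
- exact: cell_sym.
- exact: cell_trans.
- by move=> L L' x LL'; exact: cell_sub.
- exact: nbhs_cell.
- by move=> x O; exact: nbhs_cellP.
Qed.

Lemma haar_rotation_invariant (mu : probability (borel H) R) : is_haar mu ->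
  invariant_measure (@rotation B : borel H -> borel H) mu.
Proof.
move=> haar A mA; rewrite -(haar (Delta 1) A mA); congr (mu _).
by apply/seteqP; split => h /=; rewrite /rotation addrC.
Qed.

Section rotation_invariant.
Variable mu : probability (borel H) R.
Hypothesis mu_inv : invariant_measure (@rotation B : borel H -> borel H) mu.
Local Open Scope ereal_scope.

Let cellm L h : measurable (cell L h : set (borel H)).
Proof. by apply: open_measurable; exact: cell_open. Qed.

(** The rotation maps the cell of [n] onto the cell of [n + 1]. *)
Lemma invariant_cell_eq L (n : nat) : mu (cell L (Delta n%:Z)) = mu (cell L (Delta 0)).
Proof.
elim: n => // n <-; rewrite -(mu_inv (cellm L (Delta n.+1%:Z))); congr (mu _).
have DS b : \val (Delta n.+1%:Z) b = (\val (Delta n%:Z) b + \val (Delta 1) b)%R.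
  by rewrite -val_HD -DeltaHD -addn1 PoszD.
apply/seteqP; split => g gn b bL.
  by have := gn b bL; rewrite /rotation val_HD DS => /addIr.
by rewrite /rotation val_HD DS gn.
Qed.

(** The cells of level [L] are permuted cyclically by the rotation, so they have
the same measure. This determines the measure of all saturated sets; hence there
is only one rotation-invariant probability, the Haar measure. *)
Lemma invariant_saturated L (A : set (borel H)) : saturated (@cell B) L A ->
  mu A = ((count_upto (fun k => `[< A (Delta k%:Z) >]) (lev L))%:R / (lev L)%:R)%:E.
Proof.
move=> sA.
set q := lev L; have q0 : (0 < q)%N := level_modulus_gt0 B_pos L.
pose p := mu (cell L (Delta 0)).
pose F (k : 'I_q) : set (borel H) := cell L (Delta k.+1%:Z).
have tF : trivIset setT F.
  move=> i j _ _ [h [ih jh]]; apply: val_inj => /=.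
  have : cell L (Delta i.+1%:Z) (Delta j.+1%:Z) by exact: cell_trans ih (cell_sym jh).
  move=> /(Delta_cellP B_pos); rewrite -/q.
  move: (ltn_ord i) (ltn_ord j) => iq jq /dvdzP[k kE].
  have k0 : k = 0%R by nia.
  by move: kE; rewrite k0 mul0r; lia.
have sumF (P : pred 'I_q) : mu (\big[setU/set0]_(i < q | P i) F i) = \sum_(i < q | P i) p.
  rewrite measure_bigsetU_ord//; last by move=> i; exact: cellm.
  by apply: eq_bigr => i _; exact: invariant_cell_eq.
have hF h : exists i : 'I_q, F i h.
  have [n hn] := cell_Delta B_pos L h.
  have q0z : q%:Z != 0%R by rewrite eqz_nat -lt0n.
  pose k := ((n - 1)%R %% q%:Z)%Z.
  have kE : (absz k)%:Z = k by rewrite gez0_abs// modz_ge0.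
  have kq : (absz k < q)%N by rewrite -ltz_nat kE ltz_mod.
  exists (Ordinal kq); apply: cell_trans (cell_sym hn).
  apply/(Delta_cellP B_pos) => /=; rewrite -addn1 PoszD kE.
  have -> : (n - (k + 1) = ((n - 1)%R %/ q%:Z)%Z * q%:Z)%R.
    by have := divz_eq (n - 1)%R q%:Z; rewrite -/k => h1; lia.
  exact: dvdz_mull.
have unionE (X : set (borel H)) : saturated (@cell B) L X ->
    X = \big[setU/set0]_(i < q | `[< X (Delta i.+1%:Z) >]) F i.
  move=> sX; rewrite -bigcup_seq_cond; apply/seteqP; split => h.
    move=> Xh; have [i ih] := hF h; exists i => //=.
    rewrite mem_index_enum/=; apply/asboolP; apply: sX Xh; exact: cell_sym.
  by move=> [i /= /andP[_ /asboolP Xi] ih]; exact: sX ih Xi.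
have pfin : p \is a fin_num by exact: fin_num_measure.
have sumE (P : pred 'I_q) : \sum_(i < q | P i) p = ((\sum_(i < q | P i) 1)%N%:R * fine p)%:E.
  rewrite -(fineK pfin) sumEFin sumr_const sum1_card mulr_natl/=.
  by congr (_%:E); congr (_ *+ _); apply: eq_card.
have pE : fine p = ((q%:R)^-1)%R.
  have := unionE setT (fun _ _ _ => id).
  move=> /(congr1 mu); rewrite probability_setT sumF sumE => -[].
  rewrite (eq_bigl predT); last by move=> i; apply/asboolP.
  rewrite sum1_card card_ord => h; apply: (mulfI (x := q%:R)).
    by rewrite pnatr_eq0 -lt0n.
  by rewrite -h divff// pnatr_eq0 -lt0n.
rewrite {1}(unionE A sA) sumF sumE pE; congr (_%:R / _)%:E.
rewrite /count_upto big_add1/= big_mkord [LHS]big_mkcond/=.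
by apply: eq_bigr => i _; case: asboolP.
Qed.

End rotation_invariant.
End haar.

(** * Regularity makes the boundary of the window null *)

(** The error in counting up to [L] instead of up to a multiple of [q] is at most
[q]. *)
Lemma natural_density_periodic (R : realType) (A : set int) (q : nat) :
  (0 < q)%N -> (forall n, A (n + q%:Z) <-> A n) ->
  natural_density R A = (count_upto (fun k => `[< A k%:Z >]) q)%:R / q%:R.
Proof.
move=> q0 Aq; pose P k := `[< A k%:Z >]; pose c := count_upto P q.
have Pq u : P (u + q)%N = P u.
  by apply: asbool_equiv_eq; rewrite PoszD.
have qR : (0 : R) < q%:R by rewrite ltr0n.
apply/cvg_lim => //; apply/cvgrPdist_le => e e0; near=> L.
have L0 : (0 < L)%N by near: L; exact: nbhs_infty_gt.
have LR : (0 : R) < L%:R by rewrite ltr0n.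
rewrite -[X in X%:R / L%:R]/(count_upto P L) -/(count_upto P q) -/c.
have bound : `|c%:R * L%:R - (count_upto P L)%:R * q%:R| <= q%:R * q%:R :> R.
  rewrite {1 2}(divn_eq L q); set m := (L %/ q)%N; set r := (L %% q)%N.
  have rq : (r < q)%N by rewrite ltn_mod.
  have cq : (c <= q)%N by exact: count_upto_le.
  have sr := count_upto_le (fun u => P (m * q + u)%N) r.
  rewrite count_upto_add count_upto_periodic// -/c.
  move: sr; set s := count_upto _ r => sr.
  rewrite !natrD !natrM -[X in `|X|]/(_ - _).
  rewrite (_ : _ - _ = c%:R * r%:R - s%:R * q%:R); last by ring.
  rewrite ler_norml -!natrM lerBlDr -natrD !lerBrDr addrC lerBlDr -!natrD !ler_nat.
  by apply/andP; split; nia.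
rewrite (_ : _ - _ = (c%:R * L%:R - (count_upto P L)%:R * q%:R) / (q%:R * L%:R)); last first.
  by field; rewrite !gt_eqF.
rewrite normrM normfV [X in _ / X]gtr0_norm ?mulr_gt0// ler_pdivrMr ?mulr_gt0//.
apply: le_trans bound _; rewrite mulrCA ler_pM2l// mulrC -ler_pdivrMr//.
by near: L; exact: nbhs_infty_ger.
Unshelve. all: by end_near. Qed.

Lemma asbool_eq_iff (P Q : Prop) : `[< P >] = `[< Q >] -> (P <-> Q).
Proof.
by move=> e; split=> h; apply/asboolP; [rewrite -e|rewrite e]; exact/asboolP.
Qed.

Section regular.
Variables (R : realType) (B : set nat).
Hypothesis B_pos : forall b, B b -> (0 < b)%N.
Local Notation C := (B `|` dilated_coprime_set B).
Local Notation lev := (level_modulus B).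
Local Notation Delta := (DeltaH B).
Local Notation W := (window B).
Local Notation H := (Hgrp B).
Local Notation eta_star := (eta_seq (star_set B)).

(** The gcds increase with the level and are bounded by [s]. *)
Lemma gcd_level_stable (s : nat) : (0 < s)%N ->
  exists L, forall L', (L <= L')%N -> gcdn s (lev L') = gcdn s (lev L).
Proof.
move=> s0; pose p v := `[< exists L, gcdn s (lev L) = v >].
have ex : exists v, p v by exists (gcdn s (lev 0)); apply/asboolP; exists 0%N.
have ub v : p v -> (v <= s)%N.
  by move=> /asboolP[L <-]; apply: dvdn_leq => //; exact: dvdn_gcdl.
case: (ex_maxnP ex ub) => v /asboolP[L Lv] vmax; exists L => L' LL'.
apply/eqP; rewrite eqn_leq Lv vmax/=; last by apply/asboolP; exists L'.
rewrite -Lv dvdn_leq ?gcdn_gt0 ?s0//.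
by rewrite dvdn_gcd dvdn_gcdl/= (dvdn_trans (dvdn_gcdr _ _))// level_modulus_dvd.
Qed.

(** The period [s] need not divide a level modulus; what matters is the gcd of
[s] with the level moduli, which stabilises at some [L]. If [n] is free, so are
all [n + s k], and a multiple of [b] in the cell of [n] would give, by Bezout's
identity, a multiple of [b] among them; so the cell is inside the window. If [n]
is not free, then no [n + s k] is free, some [d] in [C] divides [s] and [n] by
[progression_covered], and the cell avoids [window_reg]. *)
Lemma period_cells (s : nat) : (0 < s)%N -> exists L, forall n g,
  period_set eta_star s n -> cell L (Delta n) g -> ~ (window_reg B `\` W°) g.
Proof.
move=> s0; have [L Lst] := gcd_level_stable s0.
exists L => n g per gn [regg]; apply.
have [fn|nfn] := pselect (free_set (star_set B) n).
  apply/window_interiorP => //; exists L => k kg.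
  apply: contrapT => /not_windowP[b kb].
  have Bb := index_in_B b.
  pose L' := maxn L (\val b).
  have [m km] := cell_Delta B_pos L' k.
  have bm : ((\val b)%:Z %| m)%Z by rewrite -(cell_coord_eq0 B_pos (leq_maxr _ _) km).
  have /(Delta_cellP B_pos) Lmn : cell L (Delta n) (Delta m).
    apply: cell_trans gn _; apply: cell_trans kg _; apply: cell_sub km; exact: leq_maxl.
  have gs : (gcdn s (\val b) %| gcdn s (lev L))%N.
    rewrite -(Lst _ (leq_maxl L (\val b))) dvdn_gcd dvdn_gcdl/=.
    apply: dvdn_trans (dvdn_gcdr _ _) _; apply: dvdn_level_modulus => //.
    exact: leq_maxr.
  have gn' : (gcdz s%:Z (\val b)%:Z %| n)%Z.
    have -> : n = m - (m - n) by rewrite opprB addrC subrK.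
    rewrite rpredB//; first by apply: dvdz_trans bm; exact: dvdz_gcdr.
    apply: dvdz_trans Lmn; rewrite dvdzE/=; apply: dvdn_trans gs _; exact: dvdn_gcdr.
  have [u [v uv]] := Bezoutz s%:Z (\val b)%:Z.
  have /dvdzP[c nE] := gn'.
  have pe := asbool_eq_iff (per (- (c * u))).
  have := pe.2 fn => /(free_set_star B_pos)/(_ (\val b) (or_introl Bb))/negP; apply.
  have -> : n + s%:Z * - (c * u) = c * v * (\val b)%:Z by rewrite nE -uv; ring.
  exact: dvdz_mull.
exfalso.
have [k|d [Cd ds dn]] := progression_covered B_pos s0 (r := n).
  have pe := asbool_eq_iff (per k).
  apply: contrapT => none; apply: nfn; apply: pe.1.
  apply/(free_set_star B_pos) => d Cd; apply/negP => dk; apply: none.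
  by exists d.
have [L2 dL2] : exists L2, (d %| lev L2)%N.
  case: Cd => [Bd|Dd]; first by exists d; exact: dvdn_level_modulus.
  have [a [_ Ba]] := dilated_coprimeP Dd (X := 1) isT.
  exists (d * a)%N; apply: dvdn_trans (dvdn_mulr a (dvdnn d)) _.
  exact: dvdn_level_modulus.
have dL : (d %| lev L)%N.
  apply: dvdn_trans (dvdn_gcdr s _); rewrite -(Lst (maxn L L2)) ?leq_maxl//.
  rewrite dvdn_gcd ds/=; apply: dvdn_trans dL2 _; apply: level_modulus_dvd.
  exact: leq_maxr.
exact: (cell_avoids_window_reg B_pos Cd dL dn gn).
Qed.

Definition periodic_positions (r : nat) : set int :=
  \bigcup_(s in [set s | (1 <= s <= r)%N]) period_set eta_star s.

Lemma periodic_positions_cells (r : nat) : exists L, forall n g,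
  periodic_positions r n -> cell L (Delta n) g -> ~ (window_reg B `\` W°) g.
Proof.
have /choice[f fP] s : exists L, (0 < s)%N -> forall n g,
    period_set eta_star s n -> cell L (Delta n) g -> ~ (window_reg B `\` W°) g.
  have [->|s0] := posnP s; first by exists 0%N.
  by have [L hL] := period_cells s0; exists L.
pose L := (\sum_(0 <= s < r.+1) f s)%N.
exists L => n g [s /= /andP[s1 sr] per] gn.
apply: (fP s s1 n g per); apply: cell_sub gn.
have mem : s \in index_iota 0 r.+1 by rewrite mem_index_iota.
by rewrite /L (big_rem _ mem)/= leq_addr.
Qed.

Lemma periodic_positions_periodic r n :
  periodic_positions r (n + (r`!)%:Z) <-> periodic_positions r n.
Proof.
have per_add s i z : (s%:Z %| z)%Z -> period_set eta_star s i -> period_set eta_star s (i + z).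
  move=> /dvdzP[c ->] per k; rewrite -addrA.
  have -> : c * s%:Z + s%:Z * k = s%:Z * (c + k) by ring.
  by rewrite [c * _]mulrC !per.
split=> -[s /= /andP[s1 sr] per]; exists s => //=; rewrite ?s1//.
  rewrite -[n](addrK (r`!)%:Z); apply: per_add per.
  by rewrite rpredN dvdzE/=; apply: dvdn_fact; rewrite s1.
by apply: per_add per; rewrite dvdzE/=; apply: dvdn_fact; rewrite s1.
Qed.

Local Open Scope ereal_scope.

(** The cells around the positions of period at most [r] avoid the boundary. Their
union has measure at least the density of these positions, which tends to [1]. *)
Lemma window_boundary_null (mu : probability (borel H) R) :
  regular_toeplitz R eta_star ->
  invariant_measure (@rotation B : borel H -> borel H) mu ->
  mu (window_reg B `\` W°) = 0.
Proof.
move=> [_ dens] inv; set Z := _ `\` _.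
have mZ : measurable (Z : set (borel H)).
  apply: measurableD; first by apply: closed_measurable; exact: closed_closure.
  by apply: open_measurable; exact: open_interior.
have bound r : mu Z <= (1 - natural_density R (periodic_positions r))%:E.
  have [L PL] := periodic_positions_cells r.
  pose A : set (borel H) := [set h | exists2 n, periodic_positions r n & cell L (Delta n) h].
  have sA : saturated (@cell B) L A.
    by move=> h g hg [n Pn nh]; exists n => //; exact: cell_trans nh hg.
  have mA : measurable A := saturated_measurable (Hgrp_cell_system B_pos) sA.
  have ZA : Z `<=` ~` A by move=> g Zg [n Pn ng]; exact: (PL n g).
  apply: le_trans (_ : mu (~` A) <= _).
    by apply: le_measure; rewrite ?inE//; exact: measurableC.
  rewrite probability_setC// EFinB leeB//.
  rewrite (invariant_saturated B_pos inv sA) lee_fin.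
  pose P k := `[< periodic_positions r k%:Z >].
  pose Q k := `[< A (Delta k%:Z) >].
  have PQ k : P k -> Q k by move=> /asboolP Pk; apply/asboolP; exists k%:Z.
  rewrite (natural_density_periodic R (fact_gt0 r)); last exact: periodic_positions_periodic.
  have l0 := level_modulus_gt0 B_pos L.
  have Pper u : P (u + r`!)%N = P u.
    by apply: asbool_equiv_eq; rewrite PoszD; exact: periodic_positions_periodic.
  have Qper u : Q (u + lev L)%N = Q u.
    apply: asbool_equiv_eq; split; apply: sA; apply/(Delta_cellP B_pos).
      by rewrite PoszD opprD addrA subrr add0r rpredN.
    by rewrite PoszD addrAC subrr add0r.
  pose q := (r`! * lev L)%N; have q0 : (0 < q)%N by rewrite muln_gt0 fact_gt0.
  rewrite (@count_upto_ratio R P r`! q)// ?fact_gt0//; last first.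
    by move=> u; rewrite /q mulnC periodic_mul.
  rewrite (@count_upto_ratio R Q (lev L) q)//; last by move=> u; rewrite periodic_mul.
  by rewrite ler_wpM2r ?invr_ge0// ler_nat le_count_upto.
apply/eqP; rewrite eq_le measure_ge0 andbT.
have mfin : mu Z \is a fin_num by exact: fin_num_measure.
rewrite -(fineK mfin) lee_fin.
suff : (1 <= 1 - fine (mu Z))%R by rewrite lerBrDl gerDr.
apply: (cvgr_to_le dens); apply: nearW => r.
by have := bound r; rewrite -(fineK mfin) lee_fin lerBrDl lerBrDr addrC.
Qed.

End regular.

(** * Patterns between the two codings of a generic point *)

Section generic.
Variables (R : realType) (B : set nat).
Hypothesis B_pos : forall b, B b -> (0 < b)%N.
Local Notation C := (B `|` dilated_coprime_set B).
Local Notation D := (dilated_coprime_set B).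
Local Notation lev := (level_modulus B).
Local Notation Delta := (DeltaH B).
Local Notation W := (window B).
Local Notation H := (Hgrp B).

Definition cell_window (L : nat) (k : int) (I : seq int) : set H :=
  cell L (Delta k) `&` [set g | forall j, j \in I -> W (g + Delta j)].

Lemma translate_continuous (k : H) : continuous (fun h : H => h + k).
Proof.
move=> h U /nbhs_cellP[L LU].
by apply: filterS (nbhs_cell B_pos L h) => g gh; apply: LU; exact: cellD.
Qed.

Lemma cell_window_measurable L k I : measurable (cell_window L k I : set (borel H)).
Proof.
apply: measurableI; first by apply: open_measurable; exact: cell_open.
apply: closed_measurable.
rewrite (_ : [set g | _] = \bigcap_(j in [set` I]) ((fun g => g + Delta j) @^-1` W)).
  apply: closed_bigI => j _; apply: preimage_closed; last exact: window_closed.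
  by move=> x _; exact: translate_continuous.
by apply/seteqP; split => g gI j; exact: gI.
Qed.

Section invariant.
Variable mu : probability (borel H) R.
Hypothesis mu_inv : invariant_measure (@rotation B : borel H -> borel H) mu.
Local Open Scope ereal_scope.

(** Take the union of the cells, at a level above [L] and [K], of the integers with
the truncated pattern. It contains [cell_window L k I] for every [K], and by
[invariant_saturated] its measure is the density of these integers. *)
Lemma cell_window_dense L k I : mu (cell_window L k I) != 0 ->
  uniformly_dense R B (lev L) k I.
Proof.
move=> mu0; have mfin : mu (cell_window L k I) \is a fin_num.
  by apply: fin_num_measure; exact: cell_window_measurable.
exists (fine (mu (cell_window L k I))).
  by rewrite fine_gt0// lt0e mu0 measure_ge0/= ltey_eq mfin.
move=> K q q0 Lq qK; pose L1 := maxn L K.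
pose P := truncated_pattern B K (lev L) k I.
pose A : set (borel H) := [set g | exists2 n : nat, P n & cell L1 (Delta n%:Z) g].
have LL1 : (lev L %| lev L1)%N by apply: level_modulus_dvd; exact: leq_maxl.
have KL1 b : B b -> (b <= K)%N -> (b %| lev L1)%N.
  by move=> Bb bK; apply: dvdn_level_modulus => //; rewrite (leq_trans bK) ?leq_maxr.
have Pper : forall u, P (u + lev L1)%N = P u by exact: truncated_pattern_periodic.
have Pq : forall u, P (u + q)%N = P u by exact: truncated_pattern_periodic.
have sA : saturated (@cell B) L1 A.
  by move=> x y xy [n Pn nx]; exists n => //; exact: cell_trans nx xy.
have l0 := level_modulus_gt0 B_pos L1.
have PA u : `[< A (Delta u%:Z) >] = P u.
  apply/idP/idP => [/asboolP[n Pn /(Delta_cellP B_pos) nu]|Pu]; last first.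
    by apply/asboolP; exists u.
  move: Pn => /andP[Ln /asboolP Pn]; apply/andP; split.
    have -> : (u%:Z - k = (u%:Z - n%:Z) + (n%:Z - k))%R by rewrite addrA subrK.
    by rewrite rpredD//; apply: dvdz_trans nu; rewrite dvdzE.
  apply/asboolP => b j Bb bK jI; apply: contra (Pn b j Bb bK jI) => bu.
  have -> : (n%:Z + j = (u%:Z + j) - (u%:Z - n%:Z))%R by ring.
  rewrite rpredB//; apply: dvdz_trans nu; rewrite dvdzE/=; exact: KL1.
have sub : cell_window L k I `<=` A.
  move=> g [gL gW].
  have [m gm] := cell_Delta B_pos L1 g.
  have l0z : (lev L1)%:Z != 0%R by rewrite eqz_nat -lt0n.
  pose n := absz (m %% (lev L1)%:Z)%Z.
  have nE : n%:Z = (m %% (lev L1)%:Z)%Z by rewrite gez0_abs// modz_ge0.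
  have gn : cell L1 g (Delta n%:Z).
    apply: cell_trans gm _; apply/(Delta_cellP B_pos).
    rewrite nE {2}(divz_eq m (lev L1)%:Z) opprD addrCA subrr addr0 rpredN.
    exact: dvdz_mull.
  exists n; last exact: cell_sym.
  apply/andP; split.
    by apply/(Delta_cellP B_pos); apply: cell_trans gL _; apply: cell_sub gn; exact: leq_maxl.
  apply/asboolP => b j Bb bK jI; apply/negP => bnj.
  have := gW j jI (exist _ b (mem_set Bb)).
  have gnj : cell L1 (g + Delta j)%R (Delta (n%:Z + j)%R) by rewrite DeltaHD; exact: cellD.
  rewrite (cell_coord_eq0 B_pos _ gnj)/= ?bnj//.
  by rewrite (leq_trans bK) ?leq_maxr.
have muA := invariant_saturated B_pos mu_inv sA.
have : mu (cell_window L k I) <= mu A.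
  have mA : measurable A := saturated_measurable (Hgrp_cell_system B_pos) sA.
  have mW := cell_window_measurable L k I.
  by apply: le_measure; rewrite ?inE.
rewrite muA -(fineK mfin) lee_fin => le1.
rewrite -ler_pdivlMr ?ltr0n//; apply: le_trans le1 _.
rewrite (_ : count_upto _ _ = count_upto P (lev L1)); last by apply: eq_bigr => u _; rewrite PA.
by rewrite (@count_upto_ratio R P (lev L1) q).
Qed.

(** A point outside this set is in the support of the restriction of [mu] to each
set [cell_window] that contains it. *)
Definition null_windows : set H :=
  \bigcup_n (if (unpickle n : option (nat * int * seq int)) is Some (L, k, J) then
    if mu (cell_window L k J) == 0 then cell_window L k J else set0 else set0).

Lemma null_windows_negligible : mu.-negligible null_windows.
Proof.
apply: negligible_bigcup => n; case: unpickle => [[[L k] J]|]; last exact: negligible_set0.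
case: ifPn => [/eqP m0|_]; last exact: negligible_set0.
by exists (cell_window L k J); split => //; exact: cell_window_measurable.
Qed.

(** For a finite window, the ones of [z] are conditions satisfied by a set of
positive measure near [h], hence uniformly dense. Each zero of [z] comes with a
divisor in [C] of the corresponding translate of [h]: if it is in [B], the zero is
forced by the congruence that defines the cell of [h], and if it is in [D], it is
forced by [pattern_realized]. *)
Lemma between_in_X_eta (h : H) (z : biseq) : ~ null_windows h ->
  (forall n, z n -> phi h n) -> (forall n, phi_reg h n -> z n) -> X_eta B z.
Proof.
move=> hN zphi regz O /(cs_base word_cell_system)[N NO].
pose s : seq int := [seq (m%:Z - N%:Z)%R | m <- iota 0 (N + N).+1].
have sP (i : int) : (absz i <= N)%N -> i \in s.
  move=> iN; apply/mapP; exists (absz (i + N%:Z)%R); last by lia.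
  rewrite mem_iota; lia.
pose I := [seq i <- s | z i]; pose s0 := [seq i <- s | ~~ z i].
have /choice[f fP] i : exists Ld : nat * nat, ~~ z i -> [/\ C Ld.2, (Ld.2 %| lev Ld.1)%N &
    forall n, cell Ld.1 (h + Delta i)%R (Delta n) -> (Ld.2%:Z %| n)%Z].
  case: (boolP (z i)) => zi; first by exists (0%N, 0%N).
  have : ~ window_reg B (h + Delta i)%R.
    by move=> reg; move/negP: zi; apply; apply: regz; apply/asboolP.
  by move=> /(not_window_reg_divisor B_pos)[d [L hd]]; exists (L, d).
pose L := (\sum_(i <- s) (f i).1)%N.
have [r hr] := cell_Delta B_pos L h.
have IP j : j \in I -> W (h + Delta j)%R.
  by rewrite mem_filter => /andP[/zphi /asboolP].
have gd : uniformly_dense R B (lev L) r I.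
  apply: cell_window_dense; apply/negP => m0; apply: hN.
  exists (pickle ((L, r, I) : nat * int * seq int)) => //; rewrite pickleK m0; split; first exact: cell_sym.
  exact: IP.
have dP i : i \in s0 -> [/\ C (f i).2, ((f i).2 %| lev L)%N & ((f i).2%:Z %| (r + i)%R)%Z].
  rewrite mem_filter => /andP[zi si]; have [Cd dL dn] := fP i zi.
  have fL : ((f i).1 <= L)%N by rewrite /L (big_rem _ si)/= leq_addr.
  split => //; first exact: dvdn_trans dL (level_modulus_dvd _ fL).
  by apply: dn; rewrite DeltaHD; apply: cellD; apply: cell_sub hr.
(* The zeros that the congruence given by [h] does not force by itself. *)
pose s1 := [seq i <- s0 | `[< D (f i).2 >]].
have [|k [kr kI ks]] := pattern_realized B_pos (s := s1) (level_modulus_gt0 B_pos L) _ gd.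
  move=> i; rewrite mem_filter => /andP[/asboolP Di i0]; have [_ dL dr] := dP i i0.
  split; last by exists (f i).2.
  by rewrite mem_filter; move: i0; rewrite mem_filter => /andP[/negbTE ->].
exists (shift_seqn k (eta_seq B)); split; first by exists k.
apply: NO => i /sP si; rewrite /shift_seqn /eta_seq addrC.
case: (boolP (z i)) => zi.
  by apply/asboolP; apply: kI; rewrite mem_filter zi.
apply/asboolPn.
have i0 : i \in s0 by rewrite mem_filter zi.
have [[Bd|Dd] dL dr] := dP i i0; last first.
  by apply: ks; rewrite mem_filter i0 andbT; exact/asboolP.
apply; exists (f i).2 => //=.
have -> : (k + i = (k - r) + (r + i))%R by rewrite addrA subrK.
by rewrite rpredD//; apply: dvdz_trans kr; rewrite dvdzE.
Qed.

End invariant.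
End generic.

(** * Images of joinings *)

Lemma image_probability d d' (T : measurableType d) (U : measurableType d')
    (R : realType) (mu : probability T R) (f : T -> U) :
  (forall A, measurable A -> measurable (f @^-1` A)) ->
  exists nu : probability U R, forall A, nu A = mu (f @^-1` A).
Proof.
move=> mf; have mf' : measurable_fun setT f by move=> _ A mA; rewrite setTI; exact: mf.
pose X : {mfun T >-> U} := HB.pack f (isMeasurableFun.Build _ _ _ _ f mf').
by exists (distribution mu X).
Qed.

Section almost_equal.
Context {d} {T : measurableType d} {R : realType}.
Local Open Scope ereal_scope.

Lemma measure_eq_off_negligible (mu : probability T R) (N X Y : set T) :
  measurable X -> measurable Y -> mu.-negligible N ->
  (forall t, ~ N t -> (X t <-> Y t)) -> mu X = mu Y.
Proof.
move=> mX mY [N0 [mN0 N00 NN0]] XY.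
have half X' Y' : measurable X' -> measurable Y' ->
    (forall t, ~ N t -> X' t -> Y' t) -> mu X' <= mu Y'.
  move=> mX' mY' XY'; rewrite -[leRHS]adde0 -N00.
  have mU : measurable (Y' `|` N0) by exact: measurableU.
  apply: le_trans (measureU2 mu mY' mN0); apply: le_measure; rewrite ?inE//.
  move=> t Xt; have [/NN0|nN] := pselect (N t); [by right|by left; exact: XY'].
by apply/eqP; rewrite eq_le !half//; move=> t nN; move/XY: nN => -[].
Qed.

End almost_equal.

(** A set of sequences that depends on finitely many coordinates is decomposed
along the values of these coordinates, one at a time. *)
Lemma coordinates_measurable d (T : measurableType d) (f : T -> biseq) :
  (forall n, measurable [set t | f t n]) ->
  forall A : set (borel biseq), measurable A -> measurable (f @^-1` A).
Proof.
move=> mf.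
have finite_case (s : seq int) : forall A : set biseq,
    (forall x y : biseq, (forall i, i \in s -> x i = y i) -> A x -> A y) ->
    measurable (f @^-1` A).
  elim: s => [|i s IH] A As.
    have [[x Ax]|none] := pselect (exists x, A x).
      rewrite (_ : _ @^-1` _ = setT); first exact: measurableT.
      by apply/seteqP; split => // t _ /=; exact: (As x).
    rewrite (_ : _ @^-1` _ = set0); first exact: measurable0.
    by apply/seteqP; split => // t /= At; apply: none; exists (f t).
  pose upd (b : bool) (x : biseq) : biseq := fun j => if j == i then b else x j.
  have updA b : measurable (f @^-1` [set x | A (upd b x)]).
    apply: IH => x y xy; apply: As => j; rewrite inE /upd.
    by case: eqP => //= _ /xy.
  rewrite (_ : _ @^-1` A =
     ([set t | f t i] `&` f @^-1` [set x | A (upd true x)]) `|`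
     (~` [set t | f t i] `&` f @^-1` [set x | A (upd false x)])).
    apply: measurableU; apply: measurableI => //; exact: measurableC.
  have updK x : upd (x i) x = x.
    by apply/funext => j; rewrite /upd; case: eqP => [->|].
  apply/seteqP; split => t /=.
    move=> At; case: (boolP (f t i)) => fi; [left|right]; split => //.
      by have := updK (f t); rewrite fi => ->.
    by have := updK (f t); rewrite (negbTE fi) => ->.
  case=> -[fi]; first by have := updK (f t); rewrite fi => ->.
  by have := updK (f t); move/negP/negbTE: fi => -> ->.
have mO (O : set biseq) : open O -> measurable (f @^-1` O).
  move=> oO; rewrite (inner_approx_bigcup word_cell_system oO) preimage_bigcup.
  apply: bigcup_measurable => N _.
  apply: (finite_case [seq (m%:Z - N%:Z)%R | m <- iota 0 (N + N).+1]) => x y xy.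
  apply: (inner_approx_saturated word_cell_system) => i iN.
  rewrite xy//; apply/mapP; exists (absz (i + N%:Z)%R); last by lia.
  rewrite mem_iota; lia.
apply: smallest_sub => /=; last exact: mO.
split => /=.
- by rewrite preimage_set0.
- by move=> A mA; rewrite setTD preimage_setC; apply: measurableC.
- by move=> F mF; rewrite preimage_bigcup; exact: bigcup_measurable.
Qed.

Lemma shift_seqn_cell (k : int) (N : nat) (x y : biseq) :
  word_cell (N + absz k) x y -> word_cell N (shift_seqn k x) (shift_seqn k y).
Proof. by move=> xy i iN; rewrite /shift_seqn; apply: xy; lia. Qed.

Lemma shift_seqn_continuous (k : int) : continuous (shift_seqn k : biseq -> biseq).
Proof.
move=> x O /(cs_base word_cell_system)[N NO].
apply: filterS (cs_nbhs word_cell_system (N + absz k) x) => y xy.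
by apply: NO; exact: shift_seqn_cell.
Qed.

Section joinings.
Import PointedSpaces.
Variables (R : realType) (B : set nat).
Hypothesis B_pos : forall b, B b -> (0 < b)%N.
Local Notation Delta := (DeltaH B).
Local Notation W := (window B).
Local Notation H := (Hgrp B).
Local Notation HX := (Hgrp B * biseq)%type.

Lemma M_H_skew (p : HX) : M_H (Defs.skew p) = shift_seq (M_H p).
Proof.
apply/funext => n; rewrite /M_H /shift_seq /shift_seqn /Defs.skew /=.
by rewrite /phi /phi_reg /rotation -!addrA -!DeltaHD [1 + n]addrC.
Qed.

Lemma fst_measurable (A : set (borel H)) : measurable A ->
  measurable (fst @^-1` A : set (borel HX)).
Proof. by apply: (@continuous_borel_preimage HX H fst) => x; exact: cvg_fst. Qed.

Lemma snd_measurable (A : set (borel biseq)) : measurable A ->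
  measurable (snd @^-1` A : set (borel HX)).
Proof. by apply: (@continuous_borel_preimage HX biseq snd) => x; exact: cvg_snd. Qed.

Lemma shift_measurable (k : int) (A : set (borel biseq)) : measurable A ->
  measurable (shift_seqn k @^-1` A : set (borel biseq)).
Proof.
by apply: (@continuous_borel_preimage biseq biseq (shift_seqn k)); exact: shift_seqn_continuous.
Qed.

Lemma translate_measurable (k : H) (A : set (borel H)) : measurable A ->
  measurable ((fun h => h + k) @^-1` A : set (borel H)).
Proof.
by apply: (@continuous_borel_preimage H H (fun h => h + k)); exact: translate_continuous.
Qed.

Lemma M_H_measurable (A : set (borel biseq)) : measurable A ->
  measurable (@M_H B @^-1` A : set (borel HX)).
Proof.
apply: (@coordinates_measurable _ (borel HX)) => n.
have mx : measurable (snd @^-1` [set x : biseq | x n] : set (borel HX)).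
  apply: snd_measurable; apply: open_measurable.
  apply: (@saturated_open _ _ word_cell_system (absz n)) => x y xy /=.
  by rewrite xy.
have mW (V : set H) : closed V -> measurable ([set p | V (p.1 + Delta n)] : set (borel HX)).
  move=> cV; apply: (fst_measurable (A := (fun h => h + Delta n) @^-1` V)).
  by apply: translate_measurable; exact: closed_measurable.
rewrite (_ : [set _ | _] =
   ((snd @^-1` [set x : biseq | x n]) `&` [set p : HX | W (p.1 + Delta n)]) `|`
   (~` (snd @^-1` [set x : biseq | x n]) `&` [set p : HX | window_reg B (p.1 + Delta n)])).
  apply: measurableU; apply: measurableI => //.
  - by apply: mW; exact: window_closed.
  - exact: measurableC.
  - by apply: mW; exact: closed_closure.
apply/seteqP; split => -[h x] /=; rewrite /M_H/=.
  by case: (boolP (x n)) => xn /asboolP Wn; [left|right]; split => //; exact/negP.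
by case: (boolP (x n)) => xn [[] // _ Wn|[] // _ Wn]; exact/asboolP.
Qed.

Local Open Scope ereal_scope.

(** [M_H] intertwines the skew product and the shift, so images of joinings are
invariant. The first marginal avoids [null_windows], and there
[between_in_X_eta] applies to [z = M_H (h, x)]. *)
Lemma M_H_images_sub (mu : probability (borel H) R) : is_haar mu ->
  M_H_images mu `<=` inv_probability (X_eta B).
Proof.
move=> haar nu [kappa _ [rho [rho_inv rho_fst rho_snd] nuE]].
have mu_inv := haar_rotation_invariant haar.
split; last first.
  move=> A mA; rewrite !nuE//; last exact: (shift_measurable 1 mA).
  rewrite /pushforward -(rho_inv _ (M_H_measurable mA)); congr (rho _).
  by apply/seteqP; split => p /=; rewrite M_H_skew.
have mX : measurable (X_eta B : set (borel biseq)).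
  by apply: closed_measurable; exact: closed_closure.
have [N [mN N0 nullN]] := null_windows_negligible B_pos mu.
rewrite nuE// /pushforward; apply/eqP; rewrite eq_le probability_le1//=; last exact: M_H_measurable.
have N1 : rho (fst @^-1` (~` N)) = 1.
  by rewrite rho_fst ?probability_setC ?N0 ?sube0//; exact: measurableC.
rewrite -N1; apply: le_measure; rewrite ?inE.
- by apply: fst_measurable; exact: measurableC.
- exact: M_H_measurable.
- move=> [h x] /= hN; apply: (between_in_X_eta B_pos mu_inv (h := h)).
  + by move=> /nullN.
  + move=> n; rewrite /M_H/=; case: (x n) => // /asboolP reg.
    by apply/asboolP; exact: window_reg_sub reg.
  + move=> n; rewrite /M_H/=; case: (x n) => // /asboolP reg.
    by apply/asboolP; exact: window_reg_sub reg.
Qed.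

Lemma phi_Delta k : phi (Delta k) = shift_seqn k (eta_seq B).
Proof.
apply/funext => n; rewrite /phi /shift_seqn /eta_seq -DeltaHD addrC.
by apply: asbool_equiv_eq; exact: window_Delta.
Qed.

Lemma X_eta_sub : X_eta B `<=` X_phi B.
Proof.
apply: closure_subset => _ [k _ <-]; exists (Delta k) => //; exact: phi_Delta.
Qed.

Lemma inv_probability_X_eta_sub :
  @inv_probability R (X_eta B) `<=` inv_probability (X_phi B).
Proof.
move=> nu [nuX nu_inv]; split => //.
have mX : measurable (X_eta B : set (borel biseq)).
  by apply: closed_measurable; exact: closed_closure.
have mX' : measurable (X_phi B : set (borel biseq)).
  by apply: closed_measurable; exact: closed_closure.
apply/eqP; rewrite eq_le probability_le1//= -nuX; apply: le_measure; rewrite ?inE//.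
exact: X_eta_sub.
Qed.

End joinings.

(** * Lifting invariant measures to the graph of the coding *)

Section lift.
Import PointedSpaces.
Variables (R : realType) (B : set nat).
Hypothesis B_pos : forall b, B b -> (0 < b)%N.
Local Notation Delta := (DeltaH B).
Local Notation W := (window B).
Local Notation H := (Hgrp B).
Local Notation HX := (Hgrp B * biseq)%type.
Local Notation pcell := (prod_cell (@cell B) word_cell).

Lemma pcell_system : cell_system pcell.
Proof.
exact: (prod_cell_system (Hgrp_cell_system B_pos) word_cell_system).
Qed.

Lemma compact_HX : compact [set: HX].
Proof.
by rewrite -setXTT; apply: compact_setX; [exact: compact_H|exact: compact_biseq].
Qed.

Lemma phi_shift (h : H) (n : int) : phi (h + Delta n) = shift_seqn n (phi h).
Proof.
by apply/funext => m; rewrite /phi /shift_seqn -addrA -DeltaHD [n + m]addrC.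
Qed.

Lemma shift_seqnD (m n : int) (x : biseq) :
  shift_seqn m (shift_seqn n x) = shift_seqn (n + m) x.
Proof. by apply/funext => k; rewrite /shift_seqn -addrA [m + n]addrC. Qed.

(** Some point of [H] whose coding agrees with [x] up to [N]; it depends only on
the coordinates of [x] up to [N], which makes the constructions below measurable
without any selection theorem. *)
Definition sample (N : nat) (x : biseq) : H :=
  xget 0 [set h | word_cell N x (phi h)].

Lemma sample_cell N x y : word_cell N x y -> sample N x = sample N y.
Proof.
move=> xy; congr xget; apply/seteqP; split => h /= hx.
  exact: (cs_trans word_cell_system (cs_sym word_cell_system xy) hx).
exact: (cs_trans word_cell_system xy hx).
Qed.

Lemma sampleP N x : X_phi B x -> word_cell N x (phi (sample N x)).
Proof.
move=> /(_ _ (cs_nbhs word_cell_system N x))[_ [[h _ <-] hx]].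
by apply: (@xgetPex _ 0 [set h | word_cell N x (phi h)]); exists h.
Qed.

Definition graph_point (N : nat) (n : nat) (x : biseq) : HX :=
  (sample N x + Delta n%:Z, phi (sample N x + Delta n%:Z)).

Lemma skew_graph_point N n x : Defs.skew (graph_point N n x) = graph_point N n.+1 x.
Proof.
rewrite /Defs.skew /graph_point /rotation /=.
have -> : Delta n.+1%:Z = Delta n%:Z + Delta 1 by rewrite -DeltaHD -addn1 PoszD.
by rewrite addrA -[shift_seq _]/(shift_seqn 1 _) -phi_shift.
Qed.

Definition graph_event (N n : nat) (A : set HX) : set biseq :=
  [set x | A (graph_point N n x)].

Section orbit_averages.
Variable nu : probability (borel biseq) R.

Lemma graph_event_measurable N n A :
  measurable (graph_event N n A : set (borel biseq)).
Proof.
apply: (saturated_measurable word_cell_system (L := N)) => x y xy.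
by rewrite /graph_event /= /graph_point (sample_cell xy).
Qed.

Definition event_mass (N n : nat) (A : set HX) : R := fine (nu (graph_event N n A)).

Lemma event_massE N n A : nu (graph_event N n A) = (event_mass N n A)%:E.
Proof. by rewrite fineK//; apply: fin_num_measure; exact: graph_event_measurable. Qed.

Lemma event_mass01 N n A : 0 <= event_mass N n A <= 1.
Proof.
rewrite -!lee_fin -event_massE measure_ge0/=.
by apply: probability_le1; exact: graph_event_measurable.
Qed.

(** With samples that agree with [x] up to [m + m], the first [m + 1] points of the
orbit still agree up to [m] with the orbit of [x]. *)
Definition orbit_average (A : set HX) (m : nat) : R :=
  (\sum_(n < m.+1) event_mass (m + m) n A) / m.+1%:R.

Lemma orbit_average01 A m : 0 <= orbit_average A m <= 1.
Proof.
have m0 : (0 : R) < m.+1%:R by rewrite ltr0n.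
apply/andP; split.
  by rewrite divr_ge0//; apply: sumr_ge0 => n _; have /andP[] := event_mass01 (m + m) n A.
rewrite ler_pdivrMr// mul1r.
apply: le_trans (_ : \sum_(n < m.+1) 1 <= _); last by rewrite sumr_const card_ord.
by apply: ler_sum => n _; have /andP[] := event_mass01 (m + m) n A.
Qed.

Lemma event_massU N n A A' : A `&` A' = set0 ->
  event_mass N n (A `|` A') = event_mass N n A + event_mass N n A'.
Proof.
move=> AA'; apply: EFin_inj; rewrite EFinD -!event_massE -measureU//.
- exact: graph_event_measurable.
- exact: graph_event_measurable.
- apply/seteqP; split => x // [/= Ax A'x].
  by have : (A `&` A') (graph_point N n x) by []; rewrite AA'.
Qed.

Lemma orbit_averageU A A' : A `&` A' = set0 ->
  orbit_average (A `|` A') = orbit_average A \+ orbit_average A'.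
Proof.
move=> AA'; apply/funext => m /=; rewrite /orbit_average -mulrDl -big_split/=.
by congr (_ / _); apply: eq_bigr => n _; rewrite event_massU.
Qed.

Lemma orbit_average_graph A : (forall h, A (h, phi h)) -> orbit_average A = fun=> 1.
Proof.
move=> Ag; apply/funext => m; rewrite /orbit_average.
rewrite (eq_bigr (fun=> 1)); last first.
  move=> n _; rewrite /event_mass (_ : graph_event _ _ _ = setT) ?probability_setT//.
  by apply/seteqP; split => // x _; exact: Ag.
by rewrite sumr_const card_ord -[_ *+ _]/(m.+1%:R) divff// pnatr_eq0.
Qed.

Lemma orbit_average_off_graph A : (forall h, ~ A (h, phi h)) -> orbit_average A = fun=> 0.
Proof.
move=> Ag; apply/funext => m; rewrite /orbit_average big1 ?mul0r// => n _.
rewrite /event_mass (_ : graph_event _ _ _ = set0) ?measure0//.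
by apply/seteqP; split => // x; exact: Ag.
Qed.

(** The averages along an orbit and its image under the skew product differ by the
two end terms. *)
Lemma orbit_average_skew A :
  (orbit_average (@Defs.skew B @^-1` A) \- orbit_average A) m @[m --> \oo] --> (0 : R).
Proof.
apply/cvgrPdist_le => e e0; near=> m.
have m0 : (0 : R) < m.+1%:R by rewrite ltr0n.
rewrite sub0r normrN /= /orbit_average -mulrBl.
have -> : \sum_(n < m.+1) event_mass (m + m) n (@Defs.skew B @^-1` A) -
    \sum_(n < m.+1) event_mass (m + m) n A =
    event_mass (m + m) m.+1 A - event_mass (m + m) 0 A.
  have shift n : event_mass (m + m) n (@Defs.skew B @^-1` A) = event_mass (m + m) n.+1 A.
    by rewrite /event_mass /graph_event; congr (fine (nu _)); apply/seteqP;
      split => x /=; rewrite skew_graph_point.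
  rewrite (eq_bigr (fun n : 'I_m.+1 => event_mass (m + m) n.+1 A)); last by move=> n _.
  rewrite big_ord_recr/= [X in _ - X]big_ord_recl/=.
  rewrite (eq_bigr (fun n : 'I_m => event_mass (m + m) n.+1 A))//.
  rewrite [X in _ - (_ + X)](eq_bigr (fun n : 'I_m => event_mass (m + m) n.+1 A))//.
  by rewrite opprD addrACA [X in X + _]addrC addrA; ring.
rewrite normrM normfV [X in _ / X]gtr0_norm// ler_pdivrMr//.
have /andP[a0 a1] := event_mass01 (m + m) m.+1 A.
have /andP[b0 b1] := event_mass01 (m + m) 0 A.
apply: le_trans (_ : 1 <= _); first by rewrite ler_norml; lra.
rewrite mulrC -ler_pdivrMr//; apply: le_trans (_ : m%:R <= _); last by rewrite ler_nat.
by near: m; exact: nbhs_infty_ger.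
Unshelve. all: by end_near. Qed.

End orbit_averages.

Local Open Scope ereal_scope.

Lemma mass_X_phi_eq (nu : probability (borel biseq) R) (X Y : set (borel biseq)) :
  nu (X_phi B) = 1 -> measurable X -> measurable Y ->
  (forall x, X_phi B x -> (X x <-> Y x)) -> nu X = nu Y.
Proof.
move=> nuX mX mY XY.
have mXphi : measurable (X_phi B : set (borel biseq)).
  by apply: closed_measurable; exact: closed_closure.
apply: (@measure_eq_off_negligible _ _ _ nu (~` X_phi B)) => //; last first.
  by move=> x /contrapT; exact: XY.
exists (~` X_phi B); split => //; first exact: measurableC.
by rewrite probability_setC ?nuX ?subee.
Qed.

(** The ultralimit of the orbit averages of [nu] extends to a probability [rho].
It is invariant by [orbit_average_skew]. For a set of sequences that depends on
the coordinates up to [N], the averages are equal to the mass under [nu] from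
[N] on; this gives the second marginal. All averages are carried by the graph of
[phi]. *)
Lemma invariant_lift (nu : probability (borel biseq) R) :
  inv_probability (X_phi B) nu ->
  exists rho : probability (borel HX) R,
    [/\ invariant_measure (@Defs.skew B : borel HX -> borel HX) rho,
        forall A : set (borel biseq), measurable A -> rho (snd @^-1` A) = nu A &
        forall L A, saturated pcell L A -> (forall h, ~ A (h, phi h)) -> rho A = 0].
Proof.
move=> [nuX nu_inv].
have [lim limP] := bounded_ultralimit R.
pose m (A : set HX) : R := lim (orbit_average nu A).
have avg01 A n : (0 <= orbit_average nu A n <= 1)%R := orbit_average01 nu A n.
have mcst A (c : R) : (\forall n \near \oo, orbit_average nu A n = c) -> m A = c.
  move=> eqc; have [_ lc _ _] := limP _ (avg01 A); apply: lc.
  exact: cvg_near_cst.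
have [rho rhoE] : exists rho : probability (borel HX) R,
    forall L A, saturated pcell L A -> rho A = (m A)%:E.
  apply: (content_extension pcell_system compact_HX).
  - by move=> A; have [/andP[]] := limP _ (avg01 A).
  - by apply: mcst; apply: nearW => n; rewrite orbit_average_graph.
  - by apply: mcst; apply: nearW => n; rewrite orbit_average_off_graph // => h [].
  - move=> A A' AA'; have [_ _ _] := limP _ (avg01 (A `|` A')).
    by apply; [exact: avg01|exact: avg01|exact: orbit_averageU].
exists rho; split.
- have sk_cont : continuous (@Defs.skew B).
    move=> p O /(cs_base pcell_system)[L LO].
    apply: filterS (cs_nbhs pcell_system (L + 1) p) => q [/= q1 q2].
    apply: LO; split => /=; last exact: shift_seqn_cell.
    by apply: cellD; apply: cell_sub q1; exact: leq_addr.
  have sk_meas (A : set (borel HX)) : measurable A -> measurable (@Defs.skew B @^-1` A : set (borel HX)).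
    exact: (@continuous_borel_preimage HX HX (@Defs.skew B)).
  have [rho' rho'E] := image_probability rho sk_meas.
  move=> A mA; rewrite -rho'E; apply: (probability_eq_saturated pcell_system) mA => L X sX.
  rewrite rho'E (rhoE L X sX) (rhoE (L + 1)%N); last first.
    move=> p q [/= q1 q2]; apply: sX; split => /=; last exact: shift_seqn_cell.
    by apply: cellD; apply: cell_sub q1; exact: leq_addr.
  congr (_%:E); have [_ _ + _] := limP _ (avg01 (@Defs.skew B @^-1` X)).
  by apply; [exact: avg01|exact: orbit_average_skew].
- have [nu' nu'E] := image_probability rho (@snd_measurable B).
  move=> A mA; rewrite -nu'E; apply: (probability_eq_saturated word_cell_system) mA => N X sX.
  rewrite nu'E (rhoE N); last by move=> p q [_ /=]; exact: sX.
  have mX : measurable (X : set (borel biseq)).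
    by apply: open_measurable; have := saturated_open word_cell_system sX.
  have nuXfin : nu X \is a fin_num by exact: fin_num_measure.
  rewrite -(fineK nuXfin); congr (_%:E); apply: mcst; exists N => // k /= Nk.
  have mass (n : nat) : (n <= k)%N -> event_mass nu (k + k) n (snd @^-1` X) = fine (nu X).
    move=> nk; rewrite /event_mass.
    have nuS : nu (shift_seqn n%:Z @^-1` X) = nu X.
      elim: n {nk} => [|n IH].
        congr (nu _); apply/seteqP; split => x /=; rewrite (_ : shift_seqn 0 x = x)//;
          by apply/funext => j; rewrite /shift_seqn addr0.
      rewrite -IH -(nu_inv _ (shift_measurable n%:Z mX)); congr (nu _).
      apply/seteqP; split => x /=; rewrite -[shift_seq x]/(shift_seqn 1 x) shift_seqnD;
        by rewrite (_ : 1 + n%:Z = n.+1%:Z)%R// -PoszD add1n.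
    rewrite -nuS; congr fine; apply: mass_X_phi_eq => //.
    + exact: graph_event_measurable.
    + exact: shift_measurable.
    + move=> x Xx; rewrite /graph_event /= phi_shift.
      have xs : word_cell N (shift_seqn n%:Z x) (shift_seqn n%:Z (phi (sample (k + k) x))).
        apply: shift_seqn_cell; apply: (cs_mono word_cell_system _ (sampleP (N := k + k) Xx)).
        by rewrite absz_nat leq_add.
      split; first by apply: sX; exact: (cs_sym word_cell_system xs).
      exact: sX xs.
  rewrite /orbit_average (eq_bigr (fun=> fine (nu X))); last first.
    by move=> n _; apply: mass; rewrite -ltnS.
  by rewrite sumr_const card_ord -[X in (X / _)%R]mulr_natl mulrAC divff ?mul1r// pnatr_eq0.
- move=> L A sA offA; rewrite (rhoE L A sA); congr (_%:E).
  by apply: mcst; apply: nearW => n; rewrite orbit_average_off_graph.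
Qed.

End lift.

(** * The theorem *)

Section graph_lift.
Import PointedSpaces.
Variables (R : realType) (B : set nat).
Hypothesis B_pos : forall b, B b -> (0 < b)%N.
Local Notation Delta := (DeltaH B).
Local Notation W := (window B).
Local Notation H := (Hgrp B).
Local Notation HX := (Hgrp B * biseq)%type.
Local Notation pcell := (prod_cell (@cell B) word_cell).
Local Open Scope ereal_scope.

(** A coordinate of [M_H (h, x)] can differ from that of [x] only where [x] is not
between the codings of [h], or where [h] visits the boundary of the window. *)
Definition off_M_H (n : int) : set HX :=
  [set p : HX | W° (p.1 + Delta n)%R /\ ~ p.2 n] `|`
  [set p : HX | ~ W (p.1 + Delta n)%R /\ p.2 n] `|`
  [set p : HX | (window_reg B `\` W°) (p.1 + Delta n)%R].

Lemma M_H_coordinate (p : HX) n : ~ off_M_H n p -> M_H p n = p.2 n.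
Proof.
move=> off; rewrite /M_H; case: (boolP (p.2 n)) => pn.
  apply/asboolP; apply: contrapT => nW; apply: off.
  by left; right.
apply/asboolPn => reg; apply: off.
have [Wp|nWp] := pselect (W° (p.1 + Delta n)%R).
  by left; left; split => //; exact/negP.
by right.
Qed.

(** The first two parts of [off_M_H] are increasing unions of saturated sets that
do not meet the graph of [phi]. The third is the preimage of a translate of the
boundary of the window. *)
Lemma off_M_H_negligible (mu : probability (borel H) R)
    (rho : probability (borel HX) R) (n : int) :
  regular_toeplitz R (eta_seq (star_set B)) -> is_haar mu ->
  (forall A : set (borel H), measurable A -> rho (fst @^-1` A) = mu A) ->
  (forall L A, saturated pcell L A -> (forall h, ~ A (h, phi h)) -> rho A = 0) ->
  rho.-negligible (off_M_H n).
Proof.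
move=> reg haar rho_fst rho_off.
have level_negligible (F : nat -> set HX) (X : set HX) : X `<=` \bigcup_L F L ->
    (forall L, saturated pcell (L + absz n) (F L)) ->
    (forall L h, ~ F L (h, phi h)) -> rho.-negligible X.
  move=> XF sF Fg.
  suff [N [mN N0 FN]] : rho.-negligible (\bigcup_L F L).
    by exists N; split => //; exact: subset_trans FN.
  apply: negligible_bigcup => L.
  apply/negligibleP; last exact: rho_off (sF L) (Fg L).
  by apply: open_measurable; have := saturated_open (pcell_system B_pos) (sF L).
have level_cell L (p q : HX) : pcell (L + absz n) p q ->
    cell L (p.1 + Delta n)%R (q.1 + Delta n)%R /\ p.2 n = q.2 n.
  move=> [pq1 pq2]; split; last by rewrite pq2// leq_addl.
  by apply: cellD; apply: cell_sub pq1; exact: leq_addr.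
have mu_inv := haar_rotation_invariant haar.
apply: negligibleU; first apply: negligibleU.
- pose F L : set HX := [set p : HX | cell L (p.1 + Delta n)%R `<=` W /\ ~ p.2 n].
  apply: (level_negligible F).
  + by move=> p [/(window_interiorP B_pos)[L hL] pn]; exists L.
  + move=> L p q /level_cell[pq1 pq2] [pW pn]; split; last by rewrite -pq2.
    by move=> g qg; apply: pW; exact: cell_trans pq1 qg.
  + move=> L h [hW]; apply; apply/asboolP; apply: hW; exact: cell_refl.
- pose F L : set HX := [set p : HX | (exists b : B, (\val b <= L)%N /\
    \val (p.1 + Delta n)%R b == 0%R) /\ p.2 n].
  apply: (level_negligible F).
  + by move=> p [/not_windowP[b pb] pn]; exists (\val b) => //; split => //; exists b.
  + move=> L p q /level_cell[pq1 pq2] [[b [bL pb]] pn]; split; last by rewrite -pq2.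
    by exists b; rewrite (pq1 b bL).
  + move=> L h [[b [_ hb]] /asboolP]; apply/not_windowP; by exists b.
- pose Z := window_reg B `\` W°.
  have mZ : measurable (Z : set (borel H)).
    apply: measurableD; first by apply: closed_measurable; exact: closed_closure.
    by apply: open_measurable; exact: open_interior.
  have mZn := translate_measurable B_pos (Delta n) mZ.
  have Zn0 : mu ((fun h => h + Delta n)%R @^-1` Z) = 0.
    rewrite -(window_boundary_null B_pos reg mu_inv) -/Z -(haar (Delta n) Z mZ).
    by congr (mu _); apply/seteqP; split => h /=; rewrite addrC.
  exists (fst @^-1` ((fun h => h + Delta n)%R @^-1` Z)); split => //.
    exact: fst_measurable mZn.
  exact: etrans (rho_fst _ mZn) Zn0.
Qed.

(** The lift [rho] of [nu] has the Haar measure as first marginal, by uniqueness,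
and [M_H] is almost surely the second projection. *)
Lemma inv_probability_X_phi_sub (mu : probability (borel H) R) :
  regular_toeplitz R (eta_seq (star_set B)) -> is_haar mu ->
  inv_probability (X_phi B) `<=` M_H_images mu.
Proof.
move=> reg haar nu nuP; have [nuX nu_inv] := nuP.
have mu_inv := haar_rotation_invariant haar.
have [rho [rho_inv rho_snd rho_off]] := invariant_lift B_pos nuP.
have rho_fst (A : set (borel H)) : measurable A -> rho (fst @^-1` A) = mu A.
  have [mu' mu'E] := image_probability rho (@fst_measurable B).
  have mu'_inv : invariant_measure (@rotation B : borel H -> borel H) mu'.
    by move=> X mX; rewrite !mu'E -(rho_inv _ (fst_measurable mX)).
  move=> mA; rewrite -mu'E.
  apply: (probability_eq_saturated (Hgrp_cell_system B_pos)) mA => L X sX.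
  by rewrite (invariant_saturated B_pos mu'_inv sX) (invariant_saturated B_pos mu_inv sX).
exists nu; first by split => //; exact: probability_setT.
exists rho => // A mA; rewrite /pushforward -rho_snd//.
apply: (@measure_eq_off_negligible _ _ _ rho (\bigcup_k
    (if (unpickle k : option int) is Some n then off_M_H n else set0))).
- exact: snd_measurable.
- exact: M_H_measurable.
- apply: negligible_bigcup => k; case: unpickle => [n|]; last exact: negligible_set0.
  exact: off_M_H_negligible haar rho_fst rho_off.
- move=> p pN /=; suff -> : M_H p = p.2 by [].
  apply/funext => n; apply: M_H_coordinate => off; apply: pN.
  by exists (pickle n) => //; rewrite pickleK.
Qed.

End graph_lift.

Theorem theoremA (R : realType) (B : set nat)
  (B_pos : forall b, B b -> (0 < b)%N)
  (eta_star_regular : regular_toeplitz R (eta_seq (star_set B)))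
  (m_H : probability (borel (Hgrp B)) R) (m_H_haar : is_haar m_H) :
  inv_probability (X_eta B) = inv_probability (X_phi B)
    :> set (probability (borel biseq) R) /\
  inv_probability (X_phi B) = M_H_images m_H.
Proof.
have eta_phi := @inv_probability_X_eta_sub R B B_pos.
have phi_M := inv_probability_X_phi_sub B_pos eta_star_regular m_H_haar.
have M_eta := M_H_images_sub B_pos m_H_haar.
split; apply/seteqP; split => //.
- exact: subset_trans phi_M M_eta.
- exact: subset_trans M_eta eta_phi.
Qed.
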